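(* Let $n\ge2$, let $u\in W^{1,\infty}_{\mathrm{loc}}(\mathbb R^n)$ be weakly spacelike, and assume that $\mathcal h_u^q\in L^1_{\mathrm{loc}}(\mathbb R^n)$ for some $1\le q<\infty$. Then $$ \begin{cases} \mathcal H^{\,n-q/2}(\mathcal S_u)=0 & \text{if } 1\le q<n-1,\\ \mathcal S_u=\mathcal K_u=\varnothing & \text{if } q\ge n-1. \end{cases} $$ In particular, when $n=2$ and $\mathcal h_u\in L^1_{\mathrm{loc}}(\mathbb R^2)$, it follows that $\mathcal S_{\mathtt i,u}=\mathcal S_u=\mathcal K_u=\varnothing$.
   Context: $u$ is weakly spacelike if $|Du|\le1$ a.e.; $u$ is identified with its locally Lipschitz representative. $\mathcal h_u:=(1-|Du|^2)^{-1/2}$, with the convention $\mathcal h_u=\infty$ where $|Du|=1$. A light segment of $u$ is a closed segment $\overline{xy}$, $x\ne y$, with $|u(x)-u(y)|=|x-y|$. $\mathcal S_u$ is the union of all closed light segments; $\mathcal S_{\mathtt i,u}$ is the union of their relative interiors $\{(1-t)x+ty:t\in(0,1)\}$; $\mathcal K_u:=\overline{\mathcal S_u}$. $\mathcal H^s$ is the $s$-dimensional Hausdorff measure. *)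

(* Defs.v *)
From HB Require Import structures.
From mathcomp Require Import all_boot all_order all_algebra.
From mathcomp Require Import all_classical all_reals all_analysis.
Set Implicit Arguments.
Unset Strict Implicit.
Unset Printing Implicit Defensive.
Import Order.TTheory GRing.Theory Num.Theory.
Import numFieldNormedType.Exports.
Local Open Scope classical_set_scope.
Local Open Scope ring_scope.

(* R^n is ['rV[R]_n].  Its library norm is the sup norm: the library topology
   is used as is, but every metric notion goes through [enorm] below. *)

Definition rV_display : measure_display.
Proof. exact: default_measure_display. Qed.

Section measurable_rV.
Context (R : realType) (n : nat).

Let coors : 'I_n -> 'rV[R]_n -> measurableTypeR R := fun i x => x ord0 i.

Let rV_set0 : g_sigma_preimage coors set0.
Proof. exact: sigma_algebra0. Qed.

Let rV_setC A : g_sigma_preimage coors A -> g_sigma_preimage coors (~` A).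
Proof. exact: sigma_algebraC. Qed.

Let rV_bigcup (F : _^nat) : (forall i, g_sigma_preimage coors (F i)) ->
  g_sigma_preimage coors (\bigcup_i (F i)).
Proof. exact: sigma_algebra_bigcup. Qed.

(* The sigma-algebra generated by the coordinates, i.e. the Borel sets, set up
   as the library does for [n.-tuple T]. *)
HB.instance Definition _ := @isMeasurable.Build rV_display
  'rV[R]_n (g_sigma_preimage coors) rV_set0 rV_setC rV_bigcup.

End measurable_rV.

Section rV_cons.
Context (R : realType).

Definition rV_cons n (p : measurableTypeR R * 'rV[R]_n) : 'rV[R]_n.+1 :=
  \row_i if unlift ord0 i is Some j then p.2 ord0 j else p.1.

Definition rV_uncons n (x : 'rV[R]_n.+1) : measurableTypeR R * 'rV[R]_n :=
  (x ord0 ord0, \row_j x ord0 (lift ord0 j)).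

Lemma rV_cons0 n p : @rV_cons n p ord0 ord0 = p.1.
Proof. by rewrite mxE unlift_none. Qed.

Lemma rV_consS n p (j : 'I_n) : @rV_cons n p ord0 (lift ord0 j) = p.2 ord0 j.
Proof. by rewrite mxE liftK. Qed.

Lemma rV_consK n : cancel (@rV_cons n) (@rV_uncons n).
Proof.
case=> t x; rewrite /rV_uncons rV_cons0; congr (_, _).
by apply/rowP => j; rewrite mxE rV_consS.
Qed.

Lemma measurable_rV_coord n (i : 'I_n) :
  measurable_fun setT (fun x : 'rV[R]_n => x ord0 i : measurableTypeR R).
Proof.
move=> _ Y mY; rewrite setTI; apply: sub_sigma_algebra => /=.
rewrite -bigcup_seq/=; exists i => /=; first by rewrite mem_index_enum.
by exists Y => //; rewrite setTI.
Qed.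

Lemma measurable_fun_rV d (T : measurableType d) n (f : T -> 'rV[R]_n) :
  (forall i, measurable_fun setT (fun t => f t ord0 i : measurableTypeR R)) ->
  measurable_fun setT f.
Proof.
move=> mf _ Y mY; rewrite setTI.
suff: measurable `<=` image_set_system setT f measurable.
  by move=> /(_ Y mY); rewrite /image_set_system/= setTI.
apply: smallest_sub.
  exact/sigma_algebra_image/sigma_algebra_measurable.
rewrite -bigcup_seq; apply: bigcup_sub => i _ A [B mB <-].
rewrite /image_set_system/= setTI setTI.
by have := mf i measurableT _ mB; rewrite setTI.
Qed.

Lemma measurable_rV_cons n : measurable_fun setT (@rV_cons n).
Proof.
apply: measurable_fun_rV => i.
have [j ->|->] := unliftP ord0 i.
  under eq_fun do rewrite rV_consS.
  exact: (measurableT_comp (measurable_rV_coord j) measurable_snd).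
by under eq_fun do rewrite rV_cons0; exact: measurable_fst.
Qed.

Lemma measurable_rV_uncons n : measurable_fun setT (@rV_uncons n).
Proof.
apply: (@measurable_fun_pair _ _ _ _ _ _ (fun x : 'rV[R]_n.+1 => x ord0 ord0)
  (fun x => \row_j x ord0 (lift ord0 j))); first exact: measurable_rV_coord.
apply: measurable_fun_rV => i.
rewrite [X in measurable_fun _ X](_ : _ =
  fun x : 'rV[R]_n.+1 => x ord0 (lift ord0 i)).
  exact: measurable_rV_coord.
by apply/funext => x; rewrite mxE.
Qed.

End rV_cons.

Section lebesgue_rV.
Context (R : realType).

Section step.
Context (n : nat) (m : {sigma_finite_measure set 'rV[R]_n -> \bar R}).

Definition lebesgue_rV_step : set 'rV[R]_n.+1 -> \bar R :=
  pushforward (@lebesgue_measure R \x m)%E (@rV_cons R n).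

Let step0 : lebesgue_rV_step set0 = 0%E.
Proof. by rewrite /lebesgue_rV_step /pushforward preimage_set0 measure0. Qed.

Let step_ge0 A : (0 <= lebesgue_rV_step A)%E.
Proof. exact: (measure_ge0 (@lebesgue_measure R \x m)%E). Qed.

Let step_sigma_additive : semi_sigma_additive lebesgue_rV_step.
Proof.
apply: (measure_semi_sigma_additive
  (s := pushforward (@lebesgue_measure R \x m)%E (@rV_cons R n))).
exact: measurable_rV_cons.
Qed.

HB.instance Definition _ := isMeasure.Build _ _ _ lebesgue_rV_step
  step0 step_ge0 step_sigma_additive.

Let step_sigma_finite : sigma_finite setT lebesgue_rV_step.
Proof.
have /sigma_finiteP[F [TF ndF mF]] := sigma_finiteT (@lebesgue_measure R).
have /sigma_finiteP[G [TG ndG mG]] := sigma_finiteT m.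
exists (fun k => @rV_uncons R n @^-1` (F k `*` G k)).
  rewrite -preimage_bigcup (_ : \bigcup_k _ = setT) ?preimage_setT//.
  apply/seteqP; split => // -[t x] _.
  have [i _ Fi] : (\bigcup_k F k) t by rewrite -TF.
  have [j _ Gj] : (\bigcup_k G k) x by rewrite -TG.
  exists (maxn i j) => //; split.
    by move: t Fi; exact/subsetPset/ndF/leq_maxl.
  by move: x Gj; exact/subsetPset/ndG/leq_maxr.
move=> k; have [mFk Fk] := mF k; have [mGk Gk] := mG k; split.
  rewrite -[X in measurable X]setTI; apply: measurable_rV_uncons => //.
  exact: measurableX.
rewrite /lebesgue_rV_step /pushforward -comp_preimage.
rewrite (_ : _ \o _ = id); last by apply/funext => x /=; rewrite rV_consK.
by rewrite preimage_id product_measure1E// lte_mul_pinfty// ge0_fin_numE.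
Qed.

HB.instance Definition _ := Measure_isSigmaFinite.Build _ _ _ lebesgue_rV_step
  step_sigma_finite.

End step.

(* Lebesgue measure on the Borel sets of R^n, as an iterated product of the
   one-dimensional one. *)
Fixpoint lebesgue_rV n : {sigma_finite_measure set 'rV[R]_n -> \bar R} :=
  if n is k.+1 then lebesgue_rV_step (lebesgue_rV k) else \d_(0 : 'rV[R]_0).

Lemma lebesgue_rV_box n (A : 'I_n -> set (measurableTypeR R)) :
  (forall i, measurable (A i)) ->
  lebesgue_rV n [set x | forall i, A i (x ord0 i)] =
  (\prod_(i < n) lebesgue_measure (A i))%E.
Proof.
elim: n A => [|n IH] A mA /=.
  by rewrite big_ord0 diracE mem_set//= => -[].
rewrite big_ord_recl -IH// -product_measure1E//.
- rewrite /lebesgue_rV_step /pushforward; congr (_ _).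
  apply/seteqP; split => [[t x] /= h|[t x] [/= h0 h] i].
    split => [|i]; first by have := h ord0; rewrite rV_cons0.
    by have := h (lift ord0 i); rewrite rV_consS.
  by have [j ->|->] := unliftP ord0 i; rewrite ?rV_cons0 ?rV_consS.
- rewrite [X in measurable X](_ : _ = \big[setI/setT]_(i < n)
    ((fun x : 'rV[R]_n => x ord0 i : measurableTypeR R) @^-1`
      A (lift ord0 i))).
    apply: bigsetI_measurable => i _; rewrite -[X in measurable X]setTI.
    exact: measurable_rV_coord.
  by rewrite -bigcap_seq; apply/seteqP; split => x /= h i;
    [move=> _; exact: h|apply: (h i); rewrite /= mem_index_enum].
Qed.

End lebesgue_rV.

Section euclidean.
Context (R : realType) (n : nat).
Implicit Types (x y : 'rV[R]_n) (A : set 'rV[R]_n).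

Definition enorm x : R := Num.sqrt (\sum_i x ord0 i ^+ 2).

Definition closed_segment x y : set 'rV[R]_n :=
  [set z | exists2 t : R, 0 <= t <= 1 & z = (1 - t) *: x + t *: y].

Definition open_segment x y : set 'rV[R]_n :=
  [set z | exists2 t : R, 0 < t < 1 & z = (1 - t) *: x + t *: y].

(* Adding 0 to the set of distances gives the empty set diameter 0. *)
Definition diameter A : \bar R :=
  ereal_sup (0%E |` [set (enorm (x - y))%:E | x in A & y in A]).

(* The gauge (diam A)^s, with value 0 on the empty set also for s = 0. *)
Definition hausdorff_gauge (s : R) A : \bar R :=
  if A == set0 then 0%E else (diameter A `^ s)%E.

Definition hausdorff_delta (s d : R) A : \bar R :=
  ereal_inf [set (\sum_(0 <= k <oo) hausdorff_gauge s (F k))%E |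
    F in [set F : (set 'rV[R]_n)^nat |
      A `<=` \bigcup_k F k /\ forall k, (diameter (F k) <= d%:E)%E]].

(* The s-dimensional Hausdorff (outer) measure, without the normalising
   constant some authors put in front of (diam A)^s. *)
Definition hausdorff_measure (s : R) A : \bar R :=
  ereal_sup [set hausdorff_delta s d A | d in [set d : R | 0 < d]].

End euclidean.

Section sobolev.
Context (R : realType) (n : nat).
Implicit Types (u g phi : 'rV[R]_n -> R) (Du : 'rV[R]_n -> 'rV[R]_n).
Local Notation mu := (lebesgue_rV R n).

Definition locally_lipschitz u := forall x : 'rV[R]_n,
  exists2 U, nbhs x U & exists L : R, forall y z, U y -> U z ->
    `|u y - u z| <= L * enorm (y - z).

Definition L1_loc (f : 'rV[R]_n -> \bar R) :=
  forall K : set 'rV[R]_n, compact K -> mu.-integrable K f.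

Definition Linfty_loc g := measurable_fun setT g /\
  forall K : set 'rV[R]_n, compact K ->
    exists M : R, {ae mu, forall x, K x -> `|g x| <= M}.

Definition partial (i : 'I_n) phi : 'rV[R]_n -> R :=
  fun x => 'D_(delta_mx ord0 i) phi x.

(* C^infinity: all iterated partial derivatives exist and are differentiable. *)
Definition smooth phi := forall (s : seq 'I_n) (x : 'rV[R]_n),
  differentiable (foldr partial phi s) x.

Definition test_function phi :=
  smooth phi /\ compact (closure [set x | phi x != 0]).

Definition weak_partial (i : 'I_n) u g := forall phi, test_function phi ->
  (\int[mu]_x (u x * partial i phi x) = - \int[mu]_x (g x * phi x))%R.

(* [u] is in W^{1,infty}_loc(R^n), with weak gradient [Du]. *)
Definition W1infty_loc u Du := Linfty_loc u /\
  forall i, Linfty_loc (fun x => Du x ord0 i) /\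
            weak_partial i u (fun x => Du x ord0 i).

Definition weakly_spacelike Du := {ae mu, forall x, enorm (Du x) <= 1}.

(* h_u = lorentz_factor \o Du.  The value for |p| > 1 is immaterial, as
   |Du| <= 1 almost everywhere. *)
Definition lorentz_factor (p : 'rV[R]_n) : \bar R :=
  if enorm p < 1 then ((Num.sqrt (1 - enorm p ^+ 2))^-1)%:E else +oo%E.

Definition light_segment u (x y : 'rV[R]_n) :=
  x <> y /\ `|u x - u y| = enorm (x - y).

(* S_u, S_{i,u} and K_u. *)
Definition light_set u : set 'rV[R]_n :=
  [set z | exists x y, light_segment u x y /\ closed_segment x y z].

Definition light_interior_set u : set 'rV[R]_n :=
  [set z | exists x y, light_segment u x y /\ open_segment x y z].

Definition light_closure u : set 'rV[R]_n := closure (light_set u).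

End sobolev.

(* Main.v *)
From HB Require Import structures.
Require Import Defs.
From mathcomp Require Import all_boot all_order all_algebra.
From mathcomp Require Import all_classical all_reals all_analysis.
From mathcomp Require Import measurable_realfun.
From mathcomp Require Import ring lra.
Import Order.TTheory GRing.Theory Num.Theory.
Import numFieldNormedType.Exports.
Local Open Scope classical_set_scope.
Local Open Scope ring_scope.
Set Implicit Arguments.
Unset Strict Implicit.
Unset Printing Implicit Defensive.

(** Write h for the Lorentz factor. A function whose weak gradient has norm at
    most 1 is 1-Lipschitz ([spacelike_lipschitz], by mollification). On a light
    segment from x to y, in the direction e, say with u(y) = u(x) + |y - x|, the
    Lipschitz bounds u <= u(x) + |. - x| and u >= u(y) - |. - y| are both
    attained. Off the segment, at distance rho from it and at distance at least
    d from its ends, they pinch u between two functions that agree with an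
    affine function of gradient e up to O(rho^2 / d) ([light_ray_gain]). So the
    mean of 1 - Du.e over a tube of radius r and length L around the segment is
    O(r^2 / (d L)). As 1 - |Du|^2 <= 2 (1 - Du.e), the factor
    h = (1 - |Du|^2)^(-1/2) is large in the tube: the integral of h^q over it is
    at least a constant times (r^2 / (d L))^(-q/2) L r^(n-1) ([tube_energy]).

    For a tube of fixed length this is of order r^(n-1-q). If q >= n - 1 it stays
    bounded below while the measure of the tube tends to 0, against the absolute
    continuity of the integral: no light segment exists ([no_light_ray]).

    For a tube of length comparable to r it is of order r^(n - q/2). So the
    energy, the integral of h^q, of the cube of radius r around an interior
    point of a light segment is at least kappa r^s, where s = n - q/2 < n
    ([light_ray_density]). Where kappa and the range of r are uniform, a
    maximal family of N disjoint cubes of radius r centred at such points has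
    N kappa r^s at most the energy of its union, whose measure is
    O(N r^n) = O(r^(n-s)). By absolute continuity that energy tends to 0 with r,
    hence so does N r^s, and the dilated cubes cover: the H^s measure vanishes
    ([cover_of_density]).

    The density bound may fail at an end point of a light segment. But the direction
    of light segments is a Lipschitz function of their midpoint, at fixed length
    ([light_direction_lipschitz], the parallelogram identity). So the end points
    are Lipschitz images of midpoints, and every point of the light set is an
    end point of some short light segment ([light_set_ends]).

    Mean values of Du.e over tubes in an arbitrary direction e are obtained
    without slicing by lines or rotating coordinates: the derivative of
    t -> int u(y) phi(y - x - t e) dy is int (Du.e)(y) phi(y - x - t e) dy for a
    test function phi ([is_derive_mollification]), so the mean value
    theorem in the single variable t takes the place of integration along lines. *)

(** * A smooth compactly supported bump *)

Section bump.
Context (R : realType).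
Implicit Types (P : {poly R}) (k : nat) (s : R).

(** The functions P(s) (1 - s^2)^(-k) exp(-1 / (1 - s^2)) form a family closed
    under differentiation, which makes each of them smooth; the bump proper is
    the member with P = 1 and k = 0. *)
Definition bump P k s : R :=
  if s ^+ 2 < 1 then P.[s] * (1 - s ^+ 2)^-1 ^+ k * expR (- (1 - s ^+ 2)^-1)
  else 0.

Definition bump_deriv P k : {poly R} :=
  P^`() * (1 - 'X^2) ^+ 2 + (2 * k%:R)%:P * 'X * P * (1 - 'X^2) - 2%:P * 'X * P.

Lemma pow_expRN_le k (y : R) : 0 <= y -> y ^+ k * expR (- y) <= k`!%:R.
Proof.
move=> y0; rewrite expRN ler_pdivrMr; last exact: expR_gt0.
case: k => [|k]; first by rewrite expr0 fact0 mul1r -expR0 ler_expR.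
have := @expR_ge1Dxn R y k y0.
have k0 : 0 < (k.+1)`!%:R :> R by rewrite ltr0n fact_gt0.
rewrite -(@ler_pdivrMl _ _ _ _ k0) => h; apply: le_trans h; lra.
Qed.

(** The exponential beats every power of 1 / (1 - s^2), so each member vanishes
    to second order at the boundary of its support. *)
Lemma bump_quadratic P k : exists2 C, 0 <= C &
  forall s, `|bump P k s| <= C * Num.max 0 (1 - s ^+ 2) ^+ 2.
Proof.
have [ub ubP] := poly_disk_bound P 1.
exists (`|ub| * (k.+2)`!%:R) => [|s]; first by rewrite mulr_ge0.
rewrite /bump; case: ifPn => [s1|_]; last first.
  by rewrite normr0 mulr_ge0 ?sqr_ge0 ?mulr_ge0.
have y0 : 0 < 1 - s ^+ 2 by rewrite subr_gt0.
rewrite max_r; last exact: ltW.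
set y := 1 - s ^+ 2 in y0 *.
have Ps : `|P.[s]| <= `|ub|.
  apply: le_trans (ler_norm _); apply: ubP.
  by rewrite -(@expr_le1 _ 2)// -normrX ger0_norm ?sqr_ge0// ltW.
rewrite !normrM (ger0_norm (expR_ge0 _)) -mulrA -mulrA ler_pM ?mulr_ge0 ?expR_ge0//.
rewrite -ler_pdivrMr ?exprn_gt0//.
rewrite ger0_norm; last by rewrite exprn_ge0// invr_ge0 ltW.
have := @pow_expRN_le k.+2 y^-1; rewrite invr_ge0 ltW// => /(_ isT).
by rewrite -addn2 exprD (exprVn _ 2) mulrAC.
Qed.

Lemma is_derive_quadratic (f : R -> R) (s C : R) :
  (forall h, `|h| <= 1 -> `|f (h + s)| <= C * h ^+ 2) -> is_derive s 1 f 0.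
Proof.
move=> fC.
have f0 : f s = 0.
  have := fC 0; rewrite normr0 ler01 expr0n mulr0 add0r => /(_ isT).
  by rewrite normr_le0 => /eqP.
have cv : h^-1 *: (f (h *: 1 + s) - f s) @[h --> 0^'] --> (0 : R).
  rewrite f0; apply/cvgr0Pnorm_le => e e0.
  near=> h.
  have h0 : h != 0 by near: h; exact: nbhs_dnbhs_neq.
  have h1 : `|h| <= 1.
    by near: h; apply: dnbhs0_le.
  rewrite subr0 normrZ normfV ler_pdivrMl ?normr_gt0//.
  rewrite (_ : h *: 1 = h); last exact: mulr1.
  apply: le_trans (fC _ h1) _.
  rewrite -real_normK ?num_real// expr2 mulrA mulrC ler_wpM2l//.
  apply: le_trans (_ : `|C| * `|h| <= _); first by rewrite ler_wpM2r// ler_norm.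
  have C1 : 0 < `|C| + 1 by rewrite ltr_wpDl.
  apply: le_trans (_ : (`|C| + 1) * `|h| <= _); first by rewrite ler_wpM2r// lerDl.
  rewrite -ler_pdivlMl//; near: h; apply: dnbhs0_le.
  by rewrite mulr_gt0// invr_gt0.
by apply: DeriveDef; [apply/cvg_ex; exists 0|exact/cvg_lim].
Unshelve. all: by end_near. Qed.

(** Inside ]-1, 1[ this is a computation; elsewhere, the boundary points
    included, the quadratic bound forces the derivative to be 0. *)
Lemma is_derive_bump P k s :
  is_derive s 1 (bump P k) (bump (bump_deriv P k) k.+2 s).
Proof.
rewrite {2}/bump; case: ifPn => [s1|]; last first.
  rewrite -leNgt => s1.
  have [C C0 bC] := bump_quadratic P k.
  apply: (@is_derive_quadratic _ _ (C * (2 * `|s| + 1) ^+ 2)) => h h1.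
  apply: (le_trans (bC _)); rewrite -mulrA ler_wpM2l//.
  rewrite -[in leRHS](real_normK (num_real h)) -exprMn.
  have c0 : 0 <= (2 * `|s| + 1) * `|h| by rewrite mulr_ge0// addr_ge0// mulr_ge0.
  rewrite ler_pXn2r ?nnegrE//; last by rewrite le_max lexx.
  rewrite ge_max c0 /=.
  have h2 : - (s * h) <= `|s| * `|h| by rewrite -normrM -normrN ler_norm.
  have h3 : 0 <= `|h| by [].
  have h4 : 0 <= h ^+ 2 by rewrite sqr_ge0.
  by rewrite sqrrD; nra.
have y0 : 1 - s ^+ 2 != 0 by rewrite subr_eq0 gt_eqF.
pose g := fun t : R => P.[t] * (1 - t ^+ 2)^-1 ^+ k * expR (- (1 - t ^+ 2)^-1).
apply: (@near_eq_is_derive _ _ _ g).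
  have : \forall t \near s, t ^+ 2 < 1.
    have cs : (fun t : R => t ^+ 2) t @[t --> s] --> s ^+ 2 by exact: exprn_continuous.
    by apply: (cs [set x | x < 1]); apply: lt_nbhsl.
  by apply: filterS => t t1; rewrite /g /bump t1.
have dy : is_derive s 1 (fun t : R => 1 - t ^+ 2) (- (2 * s)).
  apply: is_derive_eq.
  by rewrite (_ : s%:A = s); [ring|exact: mulr1].
have dV : is_derive s 1 (fun t : R => (1 - t ^+ 2)^-1) (2 * s * (1 - s ^+ 2)^-1 ^+ 2).
  have /= := @is_deriveV _ (fun t : R => 1 - t ^+ 2) s _ 1 y0 dy.
  by rewrite -exprVn (_ : _ *: _ = 2 * s * (1 - s ^+ 2)^-1 ^+ 2)// /GRing.scale /=; ring.
have dE : is_derive s 1 (fun t : R => expR (- (1 - t ^+ 2)^-1))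
   (expR (- (1 - s ^+ 2)^-1) * - (2 * s * (1 - s ^+ 2)^-1 ^+ 2)).
  exact: (@is_derive1_comp _ expR (fun t : R => - (1 - t ^+ 2)^-1)).
have dP := is_derive_poly P s.
have dK : is_derive s 1 (fun t : R => (1 - t ^+ 2)^-1 ^+ k)
   (k%:R * (1 - s ^+ 2)^-1 ^+ k.-1 * (2 * s * (1 - s ^+ 2)^-1 ^+ 2)).
  by have := @is_deriveX _ _ (fun t : R => (1 - t ^+ 2)^-1) k s 1 _ dV; rewrite exprfctE.
have dg := is_deriveM (is_deriveM dP dK) dE.
apply: (is_derive_eq dg); apply/esym.
have sE (a b : R) : a *: b = a * b by [].
have bE : (bump_deriv P k).[s] = P^`().[s] * (1 - s ^+ 2) ^+ 2 +
    2 * k%:R * s * P.[s] * (1 - s ^+ 2) - 2 * s * P.[s].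
  by rewrite /bump_deriv !hornerE; ring.
rewrite fctE !sE bE {bE}.
have yV : (1 - s ^+ 2) * (1 - s ^+ 2)^-1 = 1 by rewrite mulfV.
move: yV; set y := 1 - s ^+ 2; set w := y^-1 => yw.
move: {dK dg g dE dV dP} (P^`()) => Q.
case: k => [|k].
  transitivity ((Q.[s] * (y * w) ^+ 2 - 2 * s * P.[s] * w ^+ 2) * expR (- w)).
    by ring.
  by rewrite yw; ring.
transitivity ((Q.[s] * (y * w) ^+ 2 + 2 * k.+1%:R * s * P.[s] * (y * w) * w
   - 2 * s * P.[s] * w ^+ 2) * w ^+ k.+1 * expR (- w)); first by rewrite (exprD w 2 k.+1); ring.
by rewrite yw [k.+1.-1]/= (exprS w k); ring.
Qed.
End bump.

Section bumps.
Context (R : realType) (n : nat).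
Implicit Types (F : 'I_n -> {poly R} * nat) (x v a : 'rV[R]_n).

(** Products of one-variable bumps in the coordinates: partial derivatives act
    on one factor and stay in the family. *)
Definition bumps F x : R := \prod_i bump (F i).1 (F i).2 (x ord0 i).

Definition bumps_upd F (j i : 'I_n) : {poly R} * nat :=
  if i == j then (bump_deriv (F i).1 (F i).2, (F i).2.+2) else F i.

Lemma derive_partial (f : 'rV[R]_n -> R) x v : differentiable f x ->
  'D_v f x = \sum_j v ord0 j * partial j f x.
Proof.
move=> df; rewrite deriveE// [in LHS](row_sum_delta v) linear_sum.
by apply: eq_bigr => j _; rewrite linearZ /partial deriveE.
Qed.

Lemma differentiable_bumps F x : differentiable (bumps F) x.
Proof.
rewrite /bumps.
have d i : differentiable (fun y : 'rV[R]_n => bump (F i).1 (F i).2 (y ord0 i)) x.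
  apply: (@differentiable_comp _ _ _ _ (fun y : 'rV[R]_n => y ord0 i)).
    exact: differentiable_coord.
  apply/derivable1_diffP; exact: (@ex_derive _ _ _ _ _ _ _ (is_derive_bump _ _ _)).
elim: (index_enum _) => [|i s IH].
  by under eq_fun do rewrite big_nil; exact: differentiable_cst.
by under eq_fun do rewrite big_cons; exact: differentiableM.
Qed.

Lemma partial_bumps F j : partial j (bumps F) = bumps (bumps_upd F j).
Proof.
apply/funext => x; rewrite /partial /derive.
pose C := \prod_(i < n | i != j) bump (F i).1 (F i).2 (x ord0 i).
pose g (t : R) := bump (F j).1 (F j).2 t * C.
have -> : (fun h : R => h^-1 *: (bumps F (h *: delta_mx ord0 j + x) - bumps F x)) =
   (fun h : R => h^-1 *: (g (h *: 1 + x ord0 j) - g (x ord0 j))).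
  apply/funext => h; congr (_ *: (_ - _)).
    rewrite /bumps (bigD1 j)//= !mxE !eqxx /g; congr (_ * _).
    by apply: eq_bigr => i ij; rewrite !mxE eqxx (negbTE ij) mulr0 add0r.
  by rewrite /bumps (bigD1 j).
have dg : is_derive (x ord0 j) 1 g (bump (bump_deriv (F j).1 (F j).2) (F j).2.+2 (x ord0 j) * C).
  have := @is_deriveM _ _ _ (cst C) _ _ _ _
    (is_derive_bump (F j).1 (F j).2 (x ord0 j)) (is_derive_cst C (x ord0 j) (1 : R)).
  by move=> h; apply: (is_derive_eq h); rewrite scaler0 add0r; exact: mulrC.
transitivity (bump (bump_deriv (F j).1 (F j).2) (F j).2.+2 (x ord0 j) * C); first by case: dg.
rewrite /bumps (bigD1 j)//= /bumps_upd eqxx/=; congr (_ * _).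
by apply: eq_bigr => i ij; rewrite (negbTE ij).
Qed.

Lemma smooth_bumps F : smooth (bumps F).
Proof.
move=> s; suff [G ->] : exists G, foldr (@partial R n) (bumps F) s = bumps G.
  exact: differentiable_bumps.
elim: s => [|i s [G IH]]; first by exists F.
by exists (bumps_upd G i); rewrite /= IH partial_bumps.
Qed.

Definition zoom a (r : R) x := r^-1 *: (x - a).

(** A zoom maps the line x + h v to the line of direction v / r, so the
    derivative is read off the difference quotient. *)
Lemma derive_zoom (f : 'rV[R]_n -> R) a r x v :
  'D_v (f \o zoom a r) x = 'D_(r^-1 *: v) f (zoom a r x).
Proof.
rewrite /derive (_ : (fun h : R => h^-1 *: ((f \o zoom a r) (h *: v + x) - _)) =
  (fun h : R => h^-1 *: (f (h *: (r^-1 *: v) + zoom a r x) - f (zoom a r x))))//.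
apply/funext => h /=; congr (_ *: (f _ - _)).
by rewrite /zoom -addrA scalerDr !scalerA mulrC.
Qed.

Lemma partial_zoom (f : 'rV[R]_n -> R) a r i x : differentiable f (zoom a r x) ->
  partial i (f \o zoom a r) x = r^-1 * partial i f (zoom a r x).
Proof.
move=> df; rewrite /partial derive_zoom derive_partial// (bigD1 i)//= big1 => [|j ji].
  by rewrite addr0 !mxE !eqxx mulr1.
by rewrite !mxE (negbTE ji) andbF mulr0 mul0r.
Qed.

Lemma smooth_zoom (f : 'rV[R]_n -> R) a r : smooth f -> smooth (f \o zoom a r).
Proof.
move=> sf s; suff -> : foldr (@partial R n) (f \o zoom a r) s =
    r^-1 ^+ size s *: (foldr (@partial R n) f s \o zoom a r).
  by move=> x; apply: differentiableZ; exact: differentiable_comp.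
elim: s => [|i s IH]; first by rewrite scale1r.
apply/funext => x /=; rewrite IH.
rewrite /partial deriveZ; last first.
  by apply: diff_derivable; exact: differentiable_comp.
rewrite -/(partial i (foldr (@partial R n) f s \o zoom a r) x) partial_zoom//.
by rewrite exprSr; exact: mulrA.
Qed.
End bumps.

(** * Cubes *)

Section cube.
Context (R : realType) (n : nat).
Implicit Types (a x y : 'rV[R]_n) (r : R).

Definition cube a r : set 'rV[R]_n :=
  [set y | forall i, `|y ord0 i - a ord0 i| <= r].

Lemma cubeE a r : cube a r =
  [set y | forall i, (`[a ord0 i - r, a ord0 i + r]%classic : set R) (y ord0 i)].
Proof.
by apply/seteqP; split => y /= h i; have := h i; rewrite /= in_itv/= ler_distl.
Qed.

Lemma compact_cube a r : compact (cube a r).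
Proof.
rewrite cubeE; apply: (@rV_compact R n (fun i => `[a ord0 i - r, a ord0 i + r]%classic)) => i.
exact: segment_compact.
Qed.

Lemma measurable_cube a r : measurable (cube a r).
Proof.
rewrite (_ : cube a r = \bigcap_(i in [set: 'I_n])
    ((fun y : 'rV[R]_n => y ord0 i : measurableTypeR R) @^-1`
     `[a ord0 i - r, a ord0 i + r]%classic)); last first.
  by rewrite cubeE; apply/seteqP; split => y /= h i; [move=> _|]; exact: h.
apply: fin_bigcap_measurable => // i _; rewrite -[X in measurable X]setTI.
exact: measurable_rV_coord.
Qed.

Lemma lebesgue_cube a r : 0 <= r -> lebesgue_rV R n (cube a r) = ((2 * r) ^+ n)%:E.
Proof.
move=> r0; rewrite cubeE (@lebesgue_rV_box R n (fun i => `[a ord0 i - r, a ord0 i + r]%classic))//.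
rewrite (eq_bigr (fun=> (2 * r)%:E)) => [|i _].
  by rewrite prodEFin prodr_const card_ord.
rewrite /= lebesgue_measure_itv/= lte_fin; case: ifPn => [_|].
  by rewrite -EFinD; congr EFin; ring.
by rewrite -leNgt => h; congr EFin; lra.
Qed.
End cube.

(** * Mollifiers *)

Section mollifier.
Context (R : realType) (n : nat).
Implicit Types (F : 'I_n -> {poly R} * nat) (a x y v : 'rV[R]_n) (r : R).
Local Notation mu := (lebesgue_rV R n).

Lemma bumps_bounded F : exists2 C, 0 <= C & forall x, `|bumps F x| <= C.
Proof.
have b (p : {poly R} * nat) : exists C, 0 <= C /\ forall s, `|bump p.1 p.2 s| <= C.
  have [C C0 bC] := bump_quadratic p.1 p.2; exists C; split => // s.
  apply: le_trans (bC s) _; rewrite ler_piMr// expr_le1//.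
    by rewrite ge_max ler01 lerBlDr lerDl sqr_ge0.
  by rewrite le_max lexx.
have /choice[B hB] i := b (F i).
exists (\prod_i B i) => [|x]; first by rewrite prodr_ge0// => i _; case: (hB i).
rewrite /bumps normr_prod; apply: ler_prod => i _.
by rewrite normr_ge0/=; case: (hB i).
Qed.

Lemma bumps_out F x : ~ cube 0 1 x -> bumps F x = 0.
Proof.
move=> /existsNP[i]; rewrite mxE subr0 => /negP; rewrite -ltNge => xi.
rewrite /bumps (bigD1 i)//= /bump ifF ?mul0r//; apply/negbTE.
by rewrite -leNgt -real_normK ?num_real// expr_ge1// ltW.
Qed.

Lemma measurable_bumps F : measurable_fun setT (bumps F).
Proof.
apply: measurable_prod => i _.
apply: (@measurableT_comp _ _ _ _ _ _ (bump (F i).1 (F i).2) _ (fun x : 'rV[R]_n => x ord0 i)).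
  apply: continuous_measurable_fun => s; apply: differentiable_continuous.
  apply/derivable1_diffP; exact: (@ex_derive _ _ _ _ _ _ _ (is_derive_bump _ _ _)).
exact: measurable_rV_coord.
Qed.

Lemma measurable_zoom a r : measurable_fun setT (zoom a r).
Proof.
apply: measurable_fun_rV => i; rewrite /zoom.
rewrite (_ : (fun t => _) = (fun t : 'rV[R]_n => r^-1 * (t ord0 i - a ord0 i))).
  apply: measurable_funM => //; apply: measurable_funB => //; exact: measurable_rV_coord.
by apply/funext => t; rewrite !mxE.
Qed.

Definition mollifier a r : 'rV[R]_n -> R := bumps (fun=> (1, 0%N)) \o zoom a r.

Lemma smooth_moll a r : smooth (mollifier a r).
Proof. exact/smooth_zoom/smooth_bumps. Qed.

Lemma cube_zoom a r x : 0 < r -> cube 0 1 (zoom a r x) <-> cube a r x.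
Proof.
move=> r0; split => h i; have := h i; rewrite !mxE subr0 normrM gtr0_norm ?invr_gt0//.
  by rewrite ler_pdivrMl// mulr1.
by rewrite ler_pdivrMl// mulr1.
Qed.

Lemma moll_out a r x : 0 < r -> ~ cube a r x -> mollifier a r x = 0.
Proof. by move=> r0 xa; rewrite /mollifier/= bumps_out// => /(cube_zoom a _ r0). Qed.

Lemma test_function_moll a r : 0 < r -> test_function (mollifier a r).
Proof.
move=> r0; split; first exact: smooth_moll.
have cc : closed (cube a r).
  apply: compact_closed; first exact: norm_hausdorff.
  exact: compact_cube.
apply: subclosed_compact (@compact_cube _ _ a r) _; first exact: closed_closure.
rewrite closureE => y; apply; split => //= z /eqP.
by apply: contra_notP => zc; exact: moll_out.
Qed.

Lemma bump1_ge0 s : 0 <= bump (1 : {poly R}) 0 s.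
Proof. by rewrite /bump; case: ifP => // _; rewrite hornerC expr0 !mul1r expR_ge0. Qed.

Lemma bump1_le1 s : bump (1 : {poly R}) 0 s <= 1.
Proof.
rewrite /bump; case: ifP => // s1; rewrite hornerC expr0 !mul1r expR_le1 oppr_le0.
by rewrite invr_ge0 subr_ge0 ltW.
Qed.

Lemma moll_ge0 a r x : 0 <= mollifier a r x.
Proof. by apply: prodr_ge0 => i _; exact: bump1_ge0. Qed.

Lemma moll_le1 a r x : mollifier a r x <= 1.
Proof. by apply: prodr_ile1 => i _; rewrite bump1_ge0 bump1_le1. Qed.

(** A lower bound for the mollifier on the half cube: there each coordinate of
    the zoomed point has square at most 1/4, and 1 / (1 - 1/4) <= 2. *)
Definition moll_low : R := expR (- 2) ^+ n.

Lemma moll_low_gt0 : 0 < moll_low.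
Proof. by rewrite exprn_gt0 ?expR_gt0. Qed.

Lemma moll_ge a r x : 0 < r -> cube a (r / 2) x -> moll_low <= mollifier a r x.
Proof.
move=> r0 xa; rewrite /moll_low -[X in _ ^+ X](card_ord n) -prodr_const /mollifier /=.
apply: ler_prod => i _; rewrite expR_ge0/=.
have xi : (zoom a r x ord0 i) ^+ 2 <= 4^-1.
  have := xa i; rewrite !mxE => h; rewrite -real_normK ?num_real//.
  rewrite (_ : 4^-1 = 2^-1 ^+ 2); last by rewrite exprVn; congr (_^-1); ring.
  rewrite ler_pXn2r ?nnegrE//.
  by rewrite normrM gtr0_norm ?invr_gt0// ler_pdivrMl// (le_trans h).
rewrite /bump ifT; last by lra.
rewrite hornerC expr0 !mul1r ler_expR lerN2.
rewrite -[2](invrK) lef_pV2 ?posrE; lra.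
Qed.

Lemma measurable_moll a r : measurable_fun setT (mollifier a r).
Proof. exact: (measurableT_comp (measurable_bumps _) (measurable_zoom a r)). Qed.

Lemma partial_moll a r i : partial i (mollifier a r) =
  (fun x => r^-1 * bumps (bumps_upd (fun=> (1, 0%N)) i) (zoom a r x)).
Proof.
apply/funext => x; rewrite partial_zoom ?partial_bumps//; exact: differentiable_bumps.
Qed.

Lemma measurable_partial_moll a r i : measurable_fun setT (partial i (mollifier a r)).
Proof.
rewrite partial_moll; apply: measurable_funM => //.
exact: (measurableT_comp (measurable_bumps _) (measurable_zoom a r)).
Qed.

Lemma partial_moll_out a r i x : 0 < r -> ~ cube a r x -> partial i (mollifier a r) x = 0.
Proof.
by move=> r0 xa; rewrite partial_moll bumps_out ?mulr0// => /(cube_zoom a _ r0).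
Qed.

Lemma partial_moll_bounded r : exists2 C, 0 <= C &
  forall a i x, `|partial i (mollifier a r) x| <= C.
Proof.
have /choice[B hB] i : exists C, 0 <= C /\
    forall x, `|bumps (bumps_upd (fun=> (1, 0%N)) i) x| <= C :> R.
  by have [C C0 hC] := bumps_bounded (bumps_upd (fun=> (1, 0%N)) i); exists C.
have B0 i : 0 <= B i by case: (hB i).
exists (`|r^-1| * \sum_i B i) => [|a i x]; first by rewrite mulr_ge0// sumr_ge0.
rewrite partial_moll normrM ler_wpM2l//.
apply: le_trans (_ : B i <= _); first by case: (hB i).
by rewrite (bigD1 i)//= lerDl sumr_ge0.
Qed.

Lemma moll_shift a b r x : mollifier (a + b) r (x + b) = mollifier a r x.
Proof. by rewrite /mollifier /= /zoom opprD addrACA subrr addr0. Qed.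
End mollifier.

(** * Translation invariance of Lebesgue measure *)

Section translation.
Context (R : realType).
Local Open Scope ereal_scope.

Lemma measurable_translation1 (c : R) :
  measurable_fun setT ((fun t => t + c)%R : measurableTypeR R -> measurableTypeR R).
Proof. by apply: measurable_funD. Qed.

Lemma lebesgue_measure_translation (c : R) (A : set (measurableTypeR R)) :
  measurable A ->
  lebesgue_measure ((fun t : R => (t + c)%R) @^-1` A) = lebesgue_measure A.
Proof.
move=> mA; pose m1 := measurable_translation1 c.
pose f : {mfun measurableTypeR R >-> measurableTypeR R} :=
  HB.pack (fun t : R => (t + c)%R) (isMeasurableFun.Build _ _ _ _ _ m1).
rewrite [RHS](@lebesgue_measure_unique _ (pushforward (@lebesgue_measure R) f))//.
move=> _ [[a b] _ <-].
transitivity (lebesgue_measure (f @^-1` `]a, b]%classic)) => //.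
have -> : f @^-1` `]a, b]%classic = `](a - c)%R, (b - c)%R]%classic.
  by apply/seteqP; split => t /=; rewrite !in_itv/= ltrBlDr lerBrDr.
rewrite !lebesgue_measure_itv/= !lte_fin ltrD2r; case: ifP => // _.
by rewrite -!EFinD; congr EFin; ring.
Qed.

Lemma measurable_translation n (a : 'rV[R]_n) : measurable_fun setT (fun x : 'rV[R]_n => x + a)%R.
Proof.
apply: measurable_fun_rV => i.
rewrite (_ : (fun t => _) = (fun t : 'rV[R]_n => t ord0 i + a ord0 i)%R).
  by apply: measurable_funD => //; exact: measurable_rV_coord.
by apply/funext => t; rewrite !mxE.
Qed.

(** Translation acts on each factor of the iterated product, and a measure on
    a product is determined by its values on rectangles. *)
Lemma lebesgue_rV_translation n (a : 'rV[R]_n) (A : set 'rV[R]_n) : measurable A ->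
  lebesgue_rV R n ((fun x : 'rV[R]_n => x + a)%R @^-1` A) = lebesgue_rV R n A.
Proof.
elim: n a A => [|n IH] a A mA.
  have -> : (fun x : 'rV[R]_0 => x + a)%R = id by apply/funext => x; rewrite (thinmx0 a) addr0.
  by rewrite preimage_id.
rewrite /= /lebesgue_rV_step /pushforward.
pose a' : 'rV[R]_n := (\row_j a ord0 (lift ord0 j))%R.
pose T (p : measurableTypeR R * 'rV[R]_n) : measurableTypeR R * 'rV[R]_n :=
  ((p.1 + a ord0 ord0)%R, (p.2 + a')%R).
have mT : measurable_fun setT T.
  apply: measurable_fun_pair.
    exact: (measurableT_comp (measurable_translation1 (a ord0 ord0)) measurable_fst).
  exact: (measurableT_comp (measurable_translation a') measurable_snd).
pose f : {mfun _ >-> _} := HB.pack T (isMeasurableFun.Build _ _ _ _ _ mT).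
have mB : measurable (@rV_cons R n @^-1` A).
  by rewrite -[X in measurable X]setTI; exact: measurable_rV_cons.
rewrite [RHS](@product_measure_unique _ _ _ _ _ _ _
  (pushforward (@lebesgue_measure R \x lebesgue_rV R n) f)) => [|B C mB' mC|//].
  rewrite /pushforward; congr (_ _); apply/seteqP; split => [] [t x] /=;
  rewrite (_ : rV_cons (T (t, x)) = rV_cons (t, x) + a)%R//; apply/rowP => i;
  have [j ->|->] := unliftP ord0 i; rewrite !mxE ?rV_consS ?rV_cons0 ?liftK ?unlift_none /= ?mxE//.
transitivity ((@lebesgue_measure R \x lebesgue_rV R n) (((fun t : R => (t + a ord0 ord0)%R) @^-1` B) `*`
   ((fun x : 'rV[R]_n => x + a')%R @^-1` C))) => //.
rewrite [LHS]product_measure1E.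
- by congr (_ * _); [exact: lebesgue_measure_translation|exact: IH].
- by rewrite -[X in measurable X]setTI; exact: measurable_translation1.
- by rewrite -[X in measurable X]setTI; exact: measurable_translation.
Qed.

Lemma integral_rV_translation n (a : 'rV[R]_n) (f : 'rV[R]_n -> \bar R) :
  (lebesgue_rV R n).-integrable setT f ->
  (lebesgue_rV R n).-integrable setT (fun x => f (x + a)%R) /\
  \int[lebesgue_rV R n]_x f (x + a)%R = \int[lebesgue_rV R n]_x f x.
Proof.
move=> fi; have mf := measurable_int _ fi.
have mT := measurable_translation a.
pose g : {mfun _ >-> _} := HB.pack (fun x : 'rV[R]_n => (x + a)%R) (isMeasurableFun.Build _ _ _ _ _ mT).
have pushE h : \int[pushforward (lebesgue_rV R n) g]_x h x = \int[lebesgue_rV R n]_x h x.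
  by apply: eq_measure_integral => A mA _; rewrite /= /pushforward lebesgue_rV_translation.
have gi : (lebesgue_rV R n).-integrable setT (f \o g).
  apply/integrableP; split; first exact: (measurableT_comp mf mT).
  have /integrableP[_] := fi; rewrite -pushE ge0_integral_pushforward//.
  exact: measurableT_comp.
by split; [exact: gi|rewrite -[RHS]pushE integral_pushforward].
Qed.
End translation.

(** * The Euclidean norm *)

Section euclid.
Context (R : realType) (n : nat).
Implicit Types x y z : 'rV[R]_n.

Definition dot x y : R := \sum_i x ord0 i * y ord0 i.

Lemma dotC x y : dot x y = dot y x.
Proof. by apply: eq_bigr => i _; rewrite mulrC. Qed.

Lemma dotDl x y z : dot (x + y) z = dot x z + dot y z.
Proof. by rewrite /dot -big_split; apply: eq_bigr => i _; rewrite mxE mulrDl. Qed.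

Lemma dotZl k x y : dot (k *: x) y = k * dot x y.
Proof. by rewrite /dot mulr_sumr; apply: eq_bigr => i _; rewrite mxE mulrA. Qed.

Lemma dotNl x y : dot (- x) y = - dot x y.
Proof. by rewrite -scaleN1r dotZl mulN1r. Qed.

Lemma dotDr x y z : dot x (y + z) = dot x y + dot x z.
Proof. by rewrite dotC dotDl !(dotC x). Qed.

Lemma dotZr k x y : dot x (k *: y) = k * dot x y.
Proof. by rewrite dotC dotZl dotC. Qed.

Lemma dotNr x y : dot x (- y) = - dot x y.
Proof. by rewrite dotC dotNl dotC. Qed.

Lemma enorm_ge0 x : 0 <= enorm x. Proof. exact: sqrtr_ge0. Qed.

Lemma enorm_sqr x : enorm x ^+ 2 = dot x x.
Proof. by rewrite sqr_sqrtr// sumr_ge0// => i _; rewrite sqr_ge0. Qed.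

Lemma enorm_coord x i : `|x ord0 i| <= enorm x.
Proof.
rewrite -sqrtr_sqr ler_wsqrtr// (bigD1 i)//= lerDl sumr_ge0// => j _.
by rewrite sqr_ge0.
Qed.

Lemma enorm0_eq x : enorm x = 0 -> x = 0.
Proof.
move=> x0; apply/rowP => i; rewrite mxE; apply/eqP.
by rewrite -normr_le0 -x0 enorm_coord.
Qed.

Lemma enormZ k x : enorm (k *: x) = `|k| * enorm x.
Proof.
apply/eqP; rewrite -(@eqrXn2 _ 2)// ?mulr_ge0 ?enorm_ge0//.
by rewrite exprMn !enorm_sqr dotZl dotZr real_normK ?num_real// mulrA.
Qed.

Lemma enormN x : enorm (- x) = enorm x.
Proof. by rewrite -scaleN1r enormZ normrN1 mul1r. Qed.

Lemma enormB x y : enorm (x - y) = enorm (y - x).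
Proof. by rewrite -enormN opprB. Qed.

Lemma dot_le x y : dot x y <= enorm x * enorm y.
Proof.
have [x0|x0] := eqVneq (enorm x) 0.
  by rewrite x0 (enorm0_eq x0) mul0r -(scale0r 0) dotZl mul0r.
have [y0|y0] := eqVneq (enorm y) 0.
  by rewrite y0 (enorm0_eq y0) mulr0 -(scale0r 0) dotZr mul0r.
have xy : 0 < enorm x * enorm y by rewrite mulr_gt0// lt0r ?x0 ?y0 enorm_ge0.
have := sqr_ge0 (enorm (enorm y *: x - enorm x *: y)).
rewrite enorm_sqr !(dotDl, dotDr, dotNl, dotNr, dotZl, dotZr) -!enorm_sqr (dotC y x).
set a := enorm x in xy *; set b := enorm y in xy *; set d := dot x y => h.
rewrite -(ler_pM2l xy); nra.
Qed.

Lemma enormD x y : enorm (x + y) <= enorm x + enorm y.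
Proof.
rewrite -(@ler_pXn2r _ 2) ?nnegrE ?addr_ge0 ?enorm_ge0//.
rewrite enorm_sqr !(dotDl, dotDr) sqrrD -!enorm_sqr (dotC y x).
by have := dot_le x y; lra.
Qed.

Lemma enorm_le_cube x r : 0 <= r -> cube 0 r x -> enorm x ^+ 2 <= n%:R * r ^+ 2.
Proof.
move=> r0 xr; rewrite enorm_sqr -[n in n%:R](card_ord n) mulr_natl -sumr_const.
apply: ler_sum => i _; rewrite -expr2 -real_normK ?num_real//.
by have := xr i; rewrite mxE subr0 => h; rewrite ler_pXn2r ?nnegrE.
Qed.

Lemma enorm_le_cube1 x r : 0 <= r -> cube 0 r x -> enorm x <= n%:R * r.
Proof.
move=> r0 xr; rewrite -(@ler_pXn2r _ 2) ?nnegrE ?enorm_ge0 ?mulr_ge0//.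
apply: le_trans (enorm_le_cube r0 xr) _; rewrite exprMn ler_wpM2r ?sqr_ge0//.
by rewrite -natrX ler_nat; case: (n) => // m; rewrite leq_pmulr.
Qed.

Lemma parallelogram x y : enorm (x + y) ^+ 2 + enorm (x - y) ^+ 2 =
  2 * (enorm x ^+ 2 + enorm y ^+ 2).
Proof. by rewrite !enorm_sqr !(dotDl, dotDr, dotNl, dotNr); ring. Qed.

(** This is sqrt(t^2 + X) <= t + X / (2 t): it quantifies how little a
    transversal displacement w changes the distance to the ends of a segment. *)
Lemma enorm_offset (e w : 'rV[R]_n) t : enorm e = 1 -> 0 < t ->
  enorm (t *: e + w) <= t + dot e w + enorm w ^+ 2 / (2 * t).
Proof.
move=> e1 t0.
have t20 : 0 < 2 * t by rewrite mulr_gt0.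
have q : enorm (t *: e + w) ^+ 2 = t ^+ 2 + 2 * t * dot e w + enorm w ^+ 2.
  rewrite !enorm_sqr !(dotDl, dotDr, dotZl, dotZr) (dotC w e) -!enorm_sqr e1; ring.
have q0 := sqr_ge0 (enorm (t *: e + w)).
set Z := _ + _ / _.
have Zt : 2 * t * Z = t ^+ 2 + enorm (t *: e + w) ^+ 2.
  by rewrite /Z q; field; rewrite gt_eqF.
have Z0 : 0 <= Z.
  by rewrite -(pmulr_rge0 _ t20) Zt addr_ge0// sqr_ge0.
rewrite -(@ler_pXn2r _ 2) ?nnegrE ?enorm_ge0//.
have := sqr_ge0 (Z - t); nra.
Qed.
End euclid.

(** * Sums and almost everywhere comparison of integrals *)

Section Rintegral_extra.
Context d (T : measurableType d) (R : realType) (mu : {measure set T -> \bar R}).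

Lemma Rintegral_sum I (s : seq I) (f : I -> T -> R) :
  (forall i, mu.-integrable setT (EFin \o f i)) ->
  mu.-integrable setT (EFin \o (fun x => \sum_(i <- s) f i x)) /\
  \int[mu]_x (\sum_(i <- s) f i x) = \sum_(i <- s) \int[mu]_x f i x.
Proof.
move=> fi; elim: s => [|i s [IHi IH]].
  rewrite big_nil; under eq_fun do rewrite big_nil.
  split; first exact: integrable0.
  by rewrite /Rintegral integral0.
split; last first.
  under eq_Rintegral do rewrite big_cons.
  by rewrite RintegralD// big_cons IH.
rewrite (_ : _ \o _ = (EFin \o f i) \+ (EFin \o (fun x => \sum_(i <- s) f i x)%R))%E.
  exact: integrableD.
by apply/funext => x /=; rewrite big_cons EFinD.
Qed.

Lemma ae_le_Rintegral (f g : T -> R) :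
  mu.-integrable setT (EFin \o f) -> mu.-integrable setT (EFin \o g) ->
  {ae mu, forall x, f x <= g x} -> \int[mu]_x f x <= \int[mu]_x g x.
Proof.
move=> fi gi [N [mN N0 fgN]].
rewrite /Rintegral (negligible_integral mN measurableT fi N0).
rewrite (negligible_integral mN measurableT gi N0).
have mD : measurable ([set: T] `\` N) by exact: measurableD.
apply: le_Rintegral => //.
- exact: integrableS fi.
- exact: integrableS gi.
by move=> x [_ xN]; apply: contra_notT xN => fg; apply: fgN => /=; exact/negP.
Qed.
End Rintegral_extra.

(** * Mollification and the Lipschitz bound *)

Section mollification.
Context (R : realType) (n : nat).
Implicit Types (u g phi : 'rV[R]_n -> R) (Du : 'rV[R]_n -> 'rV[R]_n).
Implicit Types (a x y v : 'rV[R]_n) (r t : R).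
Local Notation mu := (lebesgue_rV R n).

Lemma integrable_cube g a r : 0 <= r -> Linfty_loc g ->
  mu.-integrable (cube a r) (EFin \o g).
Proof.
move=> r0 [mg /(_ _ (@compact_cube _ _ a r))[M gM]]; apply/integrableP; split.
  by apply/measurable_EFinP; exact: measurable_funTS.
apply: le_lt_trans (_ : (`|M|%:E * mu (cube a r) < +oo)%E).
  apply: integral_le_bound => //; first exact: measurable_cube.
  - by apply/measurable_EFinP; exact: measurable_funTS.
  - by apply: filterS gM => x h /h /= h'; rewrite lee_fin (le_trans h')// ler_norm.
by rewrite lebesgue_cube// -EFinM ltry.
Qed.

(** All integrands below are a locally bounded function times a bounded one that
    is supported in a cube. *)
Lemma integrable_mul_cube g phi a r C : 0 <= r -> Linfty_loc g ->
  measurable_fun setT phi -> (forall x, `|phi x| <= C) ->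
  (forall x, ~ cube a r x -> phi x = 0) ->
  mu.-integrable setT (EFin \o (fun x => g x * phi x)).
Proof.
move=> r0 gL mphi phiC phi0.
have -> : EFin \o (fun x => g x * phi x) = ((EFin \o g) \* (EFin \o phi))%E \_ (cube a r).
  apply/funext => x; rewrite /patch; case: ifPn => // /negP; rewrite inE => xa /=.
  by rewrite phi0// mulr0.
apply: (iffLR (integrable_mkcond _ (measurable_cube a r))).
apply: integrableMl.
- exact: measurable_cube.
- exact: integrable_cube.
- exact: measurable_funTS.
exists C; split; first exact: num_real.
by move=> M CM x _ /=; rewrite (le_trans (phiC _))// ltW.
Qed.

Lemma Linfty_loc_cst (c : R) : Linfty_loc (fun _ : 'rV[R]_n => c).
Proof.
by split=> [|K cK]; [exact: measurable_cst|exists `|c|; apply: aeW => x _].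
Qed.

Lemma integrable_indic_cube g a r : 0 <= r -> Linfty_loc g ->
  mu.-integrable setT (EFin \o (fun x => g x * \1_(cube a r) x)).
Proof.
move=> r0 gL; apply: (@integrable_mul_cube _ _ a r 1) => //.
- apply: measurable_indic; exact: measurable_cube.
- by move=> x; rewrite indicE normr_nat lern1 leq_b1.
- by move=> x xa; rewrite indicE memNset.
Qed.

Lemma moll_norm_le1 a r x : `|mollifier a r x| <= 1.
Proof. by rewrite ger0_norm ?moll_ge0// moll_le1. Qed.

Lemma integrable_moll g a r : 0 < r -> Linfty_loc g ->
  mu.-integrable setT (EFin \o (fun x => g x * mollifier a r x)).
Proof.
move=> r0 gL; apply: (@integrable_mul_cube _ _ a r 1) => //.
- exact: ltW.
- exact: measurable_moll.
- exact: moll_norm_le1.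
- by move=> x; exact: moll_out.
Qed.

Lemma integrable_moll1 a r : 0 < r -> mu.-integrable setT (EFin \o mollifier a r).
Proof.
move=> r0; have := @integrable_moll (fun=> 1) a r r0 (Linfty_loc_cst 1).
by under eq_fun do rewrite mul1r.
Qed.

Lemma integrable_partial_moll g a r i : 0 < r -> Linfty_loc g ->
  mu.-integrable setT (EFin \o (fun x => g x * partial i (mollifier a r) x)).
Proof.
move=> r0 gL; have [C C0 hC] := @partial_moll_bounded R n r.
apply: (@integrable_mul_cube _ _ a r C) => //.
- exact: ltW.
- exact: measurable_partial_moll.
- by move=> x; exact: partial_moll_out.
Qed.

Definition moll_mass r : R := \int[mu]_x mollifier 0 r x.

Lemma Rintegral_moll_shift g a r : 0 < r -> Linfty_loc g ->
  \int[mu]_x (g x * mollifier a r x) = \int[mu]_x (g (x + a) * mollifier 0 r x) /\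
  mu.-integrable setT (EFin \o (fun x => g (x + a) * mollifier 0 r x)).
Proof.
move=> r0 gL; have gi := @integrable_moll g a r r0 gL.
have E : (fun x => g (x + a) * mollifier a r (x + a)) = (fun x => g (x + a) * mollifier 0 r x).
  by apply/funext => x; rewrite -[X in mollifier X]add0r moll_shift.
have [ia Ia] := integral_rV_translation a gi.
have E' x : (EFin \o (fun x => g x * mollifier a r x)) (x + a) = (g (x + a) * mollifier 0 r x)%:E.
  by have /(congr1 (fun f => f x)) <- := E.
split.
  apply: (congr1 fine); apply: (etrans (esym Ia)).
  by apply: eq_integral => x _; exact: E'.
by apply: eq_integrable ia => // x _; exact: E'.
Qed.

Lemma Rintegral_moll a r : 0 < r -> \int[mu]_x mollifier a r x = moll_mass r.
Proof.
move=> r0; have [+ _] := @Rintegral_moll_shift (fun=> 1) a r r0 (Linfty_loc_cst 1).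
by under eq_Rintegral do rewrite mul1r; under [in RHS]eq_Rintegral do rewrite mul1r.
Qed.

Lemma moll_mass_ge r : 0 < r -> moll_low R n * r ^+ n <= moll_mass r.
Proof.
move=> r0.
have mc := @measurable_cube R n 0 (r / 2).
have r2 : 0 <= r / 2 by rewrite divr_ge0// ltW.
have ic := integrable_indic_cube 0 r2 (Linfty_loc_cst (moll_low R n)).
have -> : moll_low R n * r ^+ n = \int[mu]_x (moll_low R n * \1_(cube 0 (r / 2)) x).
  rewrite RintegralZl//; last first.
    have := integrable_indic_cube 0 r2 (Linfty_loc_cst 1).
    by apply: eq_integrable => // x _ /=; rewrite mul1r.
  rewrite /Rintegral integral_indic// setIT.
  rewrite [X in _ = _ * X](congr1 fine (lebesgue_cube 0 r2)) /=.
  by congr (_ * _ ^+ _); field.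
apply: le_Rintegral => //; first exact: integrable_moll1.
move=> x _; rewrite indicE; case: (boolP (x \in _)) => [|_].
  by rewrite inE mulr1; exact: moll_ge.
by rewrite mulr0 moll_ge0.
Qed.

Lemma moll_mass_gt0 r : 0 < r -> 0 < moll_mass r.
Proof.
by move=> r0; rewrite (lt_le_trans _ (moll_mass_ge r0))// mulr_gt0 ?moll_low_gt0// exprn_gt0.
Qed.

(** Moving the centre along v is the same as moving the point along -v. *)
Lemma is_derive_moll_line a v r y t :
  is_derive t 1 (fun s => mollifier (a + s *: v) r y)
    (- \sum_j v ord0 j * partial j (mollifier (a + t *: v) r) y).
Proof.
have dm : differentiable (mollifier (a + t *: v) r) y := smooth_moll _ _ [::] y.
have M h : mollifier (a + (h *: 1 + t) *: v) r y = mollifier (a + t *: v) r (h *: - v + y).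
  rewrite (_ : h *: 1 = h); last exact: mulr1.
  apply: (etrans _ (moll_shift (a + t *: v) (h *: v) r (h *: - v + y))).
  rewrite (_ : h *: - v + y + h *: v = y).
    by rewrite (_ : a + (h + t) *: v = a + t *: v + h *: v)// scalerDl -addrA (addrC (t *: v)).
  by rewrite scalerN (addrC (- _)) addrNK.
have E : (fun h : R => h^-1 *: (mollifier (a + (h *: 1 + t) *: v) r y - mollifier (a + t *: v) r y)) =
    (fun h : R => h^-1 *: (mollifier (a + t *: v) r (h *: (- v) + y) - mollifier (a + t *: v) r y)).
  by apply/funext => h; rewrite M.
have dv : derivable (mollifier (a + t *: v) r) y (- v) by exact: diff_derivable.
apply: DeriveDef; first by rewrite /derivable E.
apply: (etrans (congr1 (fun f => lim (f @ 0^')) E)).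
apply: (etrans (derive_partial (- v) dm)); rewrite -sumrN.
by apply: eq_bigr => j _; rewrite mxE mulNr.
Qed.

Lemma cube_shift a v r t x : cube (a + t *: v) r x ->
  cube a (r + `|t| * \sum_j `|v ord0 j|) x.
Proof.
move=> h i; have := h i; rewrite !mxE => hi.
have -> : x ord0 i - a ord0 i = (x ord0 i - (a ord0 i + t * v ord0 i)) + t * v ord0 i by ring.
apply: (le_trans (ler_normD _ _)); apply: lerD => //.
rewrite normrM ler_wpM2l// (bigD1 i)//= lerDl; exact: sumr_ge0.
Qed.

(** The only use of the weak gradient: differentiate under the integral sign,
    then move the derivative from the test function to u. *)
Lemma is_derive_mollification u Du a v r t : W1infty_loc u Du -> 0 < r ->
  is_derive t 1 (fun s => \int[mu]_x (u x * mollifier (a + s *: v) r x))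
    (\int[mu]_x (dot (Du x) v * mollifier (a + t *: v) r x)).
Proof.
move=> [uL uw] r0.
pose f s x := u x * mollifier (a + s *: v) r x.
pose V := \sum_j `|v ord0 j|.
have V0 : 0 <= V by exact: sumr_ge0.
have [C C0 hC] := @partial_moll_bounded R n r.
(* The cube of radius rho around a contains the supports of all mollifiers with
   parameter within 1 of t. *)
pose rho := r + (`|t| + 1) * V.
have rho0 : 0 <= rho by apply: addr_ge0; [exact: ltW|rewrite mulr_ge0// addr_ge0].
pose G x := `|u x * \1_(cube a rho) x| * (V * C).
have df (s : R) x : is_derive s 1 (f ^~ x)
    (u x * - \sum_j v ord0 j * partial j (mollifier (a + s *: v) r) x).
  have := @is_deriveZ _ _ _ (fun s : R => mollifier (a + s *: v) r x)
    (u x) s 1 _ (is_derive_moll_line a v r x s).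
  exact.
have tI : (`]t - 1, t + 1[%classic : set R) t by rewrite /= in_itv/= ltrBlDr ltrDl ltr01.
have fi (s : R) : `]t - 1, t + 1[%classic s -> mu.-integrable setT (EFin \o f s).
  by move=> _; exact: integrable_moll.
have fd (s : R) x : `]t - 1, t + 1[%classic s -> setT x -> derivable (f ^~ x) s 1.
  by move=> _ _; case: (df s x).
have G0 x : 0 <= G x by rewrite mulr_ge0// mulr_ge0.
have Gi : mu.-integrable setT (EFin \o G).
  have := integrable_norm (integrable_indic_cube a rho0 uL).
  move=> /(@integrableZr _ _ _ mu setT measurableT (V * C)).
  by apply: eq_integrable.
have fG (s : R) x : `]t - 1, t + 1[%classic s -> setT x -> `|partial1of2 f s x| <= G x.
  rewrite /= in_itv/= => /andP[s1 s2] _; rewrite partial1of2E (@derive_val _ _ _ _ _ _ _ (df s x)).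
  rewrite /G !normrM normrN -mulrA ler_wpM2l// indicE.
  case: (boolP (x \in cube a rho)) => [_|/negP xa].
    rewrite normr1 mul1r mulr_suml; apply: (le_trans (ler_norm_sum _ _ _)).
    by apply: ler_sum => j _; rewrite normrM ler_wpM2l.
  rewrite normr0 mul0r big1 ?normr0// => j _.
  rewrite partial_moll_out ?mulr0// => /cube_shift xs; apply: xa; rewrite inE.
  move=> i; apply: le_trans (xs i) _; rewrite lerD2l ler_wpM2r//.
  by rewrite ler_norml; have := ler_norm t; have := ler_norm (- t); rewrite normrN; lra.
have := @derivable_under_integral _ _ _ mu f setT measurableT t _ _ tI fi fd G G0 Gi fG.
have := @differentiation_under_integral _ _ _ mu f setT measurableT t _ _ tI fi fd G G0 Gi fG.
move=> E D; apply: DeriveDef; first exact: D.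
rewrite -derive1E; apply: etrans E _.
have -> : \int[mu]_x partial1of2 f t x =
    \int[mu]_x (\sum_j - v ord0 j * (u x * partial j (mollifier (a + t *: v) r) x)).
  apply: eq_Rintegral => x _; rewrite partial1of2E (@derive_val _ _ _ _ _ _ _ (df t x)).
  by rewrite -sumrN mulr_sumr; apply: eq_bigr => j _; ring.
have -> : \int[mu]_x (dot (Du x) v * mollifier (a + t *: v) r x) =
    \int[mu]_x (\sum_j v ord0 j * (Du x ord0 j * mollifier (a + t *: v) r x)).
  apply: eq_Rintegral => x _; rewrite mulr_suml.
  by apply: eq_bigr => j _; ring.
have i1 j : mu.-integrable setT (EFin \o (fun x => u x * partial j (mollifier (a + t *: v) r) x)).
  exact: integrable_partial_moll.
have i2 j : mu.-integrable setT (EFin \o (fun x => Du x ord0 j * mollifier (a + t *: v) r x)).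
  by apply: integrable_moll => //; case: (uw j).
have [_ ->] := @Rintegral_sum _ _ _ mu _ (index_enum 'I_n)
   (fun j x => - v ord0 j * (u x * partial j (mollifier (a + t *: v) r) x))
   (fun j => integrableZl measurableT (- v ord0 j) (i1 j)).
have [_ ->] := @Rintegral_sum _ _ _ mu _ (index_enum 'I_n)
   (fun j x => v ord0 j * (Du x ord0 j * mollifier (a + t *: v) r x))
   (fun j => integrableZl measurableT (v ord0 j) (i2 j)).
apply: eq_bigr => j _; rewrite !RintegralZl//.
have [_ ->] := uw j; first by rewrite mulrN mulNr opprK.
exact: test_function_moll.
Qed.

(** Integrals against mollifiers with different centres are compared pointwise,
    after translation to the origin. *)
Lemma moll_le_shift g h a b r K : 0 < r -> Linfty_loc g -> Linfty_loc h ->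
  (forall w, cube 0 r w -> g (w + a) + K <= h (w + b)) ->
  \int[mu]_x (g x * mollifier a r x) + K * moll_mass r <= \int[mu]_x (h x * mollifier b r x).
Proof.
move=> r0 gL hL gh.
have [-> gi] := Rintegral_moll_shift a r0 gL; have [-> hi] := Rintegral_moll_shift b r0 hL.
have mi := integrable_moll1 0 r0.
have ki : mu.-integrable setT (EFin \o (fun x => K * mollifier 0 r x)).
  exact: (integrableZl measurableT K mi).
rewrite /moll_mass -RintegralZl// -RintegralD//; apply: le_Rintegral => //.
  exact: (integrableD measurableT gi ki).
move=> x _; rewrite -mulrDl; have [xr|xr] := EM (cube 0 r x).
  by rewrite ler_wpM2r ?moll_ge0// gh.
by rewrite moll_out// !mulr0.
Qed.

Lemma Linfty_loc_dot Du v u : W1infty_loc u Du -> weakly_spacelike Du ->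
  Linfty_loc (fun x => dot (Du x) v).
Proof.
move=> [_ uw] Du1; split.
  apply: measurable_sum => i; apply: measurable_funM => //.
  by case: (uw i) => -[].
move=> K _; exists (enorm v); apply: filterS Du1 => x Dx _.
rewrite ler_norml -[leLHS]opprK -[enorm v]enormN lerNl -dotNr.
have h w : dot (Du x) w <= enorm w.
  by rewrite (le_trans (dot_le _ _))// ler_piMl ?enorm_ge0.
by rewrite opprK h/= -[enorm _]enormN opprK h.
Qed.

Lemma mollified_slope_le u Du a v r : W1infty_loc u Du -> weakly_spacelike Du -> 0 < r ->
  \int[mu]_x (dot (Du x) v * mollifier a r x) <= enorm v * moll_mass r.
Proof.
move=> uW Du1 r0.
rewrite -(Rintegral_moll a r0) -RintegralZl//; last exact: integrable_moll1.
apply: ae_le_Rintegral.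
- apply: integrable_moll => //; exact: (Linfty_loc_dot _ uW Du1).
- exact: (integrableZl measurableT (enorm v) (integrable_moll1 _ r0)).
apply: filterS Du1 => x Dx; rewrite ler_wpM2r ?moll_ge0//.
by rewrite (le_trans (dot_le _ _))// ler_piMl ?enorm_ge0.
Qed.

Lemma mollification_MVT u Du a v r s t : W1infty_loc u Du -> 0 < r -> s < t ->
  exists2 c, s < c < t &
    \int[mu]_x (u x * mollifier (a + t *: v) r x) - \int[mu]_x (u x * mollifier (a + s *: v) r x) =
    \int[mu]_x (dot (Du x) v * mollifier (a + c *: v) r x) * (t - s).
Proof.
move=> uW r0 st.
pose F t := \int[mu]_x (u x * mollifier (a + t *: v) r x).
have dF t' : is_derive t' 1 F (\int[mu]_x (dot (Du x) v * mollifier (a + t' *: v) r x)).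
  exact: is_derive_mollification.
have cF : {within `[s, t], continuous F}.
  by apply: derivable_within_continuous => t' _; case: (dF t').
have [c cst E] := MVT st (fun t _ => dF t) cF.
by exists c => //; rewrite in_itv in cst.
Qed.

Lemma mollification_lip u Du a v r s t :
  W1infty_loc u Du -> weakly_spacelike Du -> 0 < r -> s < t ->
  \int[mu]_x (u x * mollifier (a + t *: v) r x) - \int[mu]_x (u x * mollifier (a + s *: v) r x) <=
  enorm v * moll_mass r * (t - s).
Proof.
move=> uW Du1 r0 st; have [c _ ->] := mollification_MVT a v uW r0 st.
by rewrite ler_wpM2r ?subr_ge0 ?(ltW st)// (mollified_slope_le _ _ uW).
Qed.

Lemma locally_lipschitz_cube u x e : locally_lipschitz u -> 0 < e ->
  exists2 r0, 0 < r0 & forall r w, r <= r0 -> cube 0 r w -> `|u (w + x) - u x| <= e.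
Proof.
move=> /(_ x)[U /nbhs_ballP[d /= d0 dU] [L uL]] e0.
have K0 : 0 < `|L| * n%:R + 1 by rewrite ltr_wpDl// mulr_ge0.
exists (Num.min (d / 2) (e / (`|L| * n%:R + 1))).
  by rewrite lt_min !divr_gt0.
move=> r w; rewrite le_min => /andP[rd re] wr.
have [wle|] := boolP [exists i : 'I_n, true]; last first.
  move=> /existsPn n0.
  rewrite (_ : w = 0) ?add0r ?subrr ?normr0 ?ltW//.
  by apply/rowP => i; have := n0 i.
have {wle} r_ge0 : 0 <= r by have /existsP[i _] := wle; exact: le_trans (wr i).
have xU : U (w + x).
  apply: dU; split => // i j; rewrite /ball /= !mxE (ord1 i).
  rewrite opprD addrA addrAC subrr add0r normrN.
  by have := wr j; rewrite mxE subr0 => /le_lt_trans; apply; lra.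
have xU0 : U x by apply: dU; exact: ballxx.
apply: le_trans (uL _ _ xU xU0) _; rewrite addrK.
have wn := enorm_le_cube1 r_ge0 wr.
apply: le_trans (_ : `|L| * (n%:R * r) <= _).
  by apply: le_trans (_ : `|L| * enorm w <= _); rewrite ?ler_wpM2l// ler_wpM2r ?enorm_ge0 ?ler_norm.
rewrite mulrA; apply: le_trans (_ : (`|L| * n%:R + 1) * r <= _).
  by rewrite ler_wpM2r// lerDl.
by rewrite mulrC -ler_pdivlMr.
Qed.

(** The mollified function has slope at most 1 and converges to u as the radius
    tends to 0. *)
Lemma spacelike_lipschitz u Du : locally_lipschitz u -> W1infty_loc u Du ->
  weakly_spacelike Du -> forall x y, u x - u y <= enorm (x - y).
Proof.
move=> ul uW Du1 x y; rewrite -[x in u x](subrK y) addrC; set v := x - y.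
apply/ler_addgt0Pr => e e0.
have e2 : 0 < e / 2 by rewrite divr_gt0.
have [r1 r10 h1] := locally_lipschitz_cube (y + v) ul e2.
have [r2 r20 h2] := locally_lipschitz_cube y ul e2.
pose r := Num.min r1 r2; have r0 : 0 < r by rewrite lt_min r10.
have uL := uW.1.
have F1 := @moll_le_shift (fun=> u (y + v) - e / 2) u (y + v) (y + v) r 0 r0 (Linfty_loc_cst _) uL.
have F0 := @moll_le_shift u (fun=> u y + e / 2) y y r 0 r0 uL (Linfty_loc_cst _).
have {F1} : (u (y + v) - e / 2) * moll_mass r <= \int[mu]_x (u x * mollifier (y + v) r x).
  rewrite -(Rintegral_moll (y + v) r0) -RintegralZl//; last exact: integrable_moll1.
  rewrite -[leLHS]addr0 -[X in _ + X <= _](mul0r (moll_mass r)); apply: F1 => w wr; rewrite addr0.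
  have := h1 r w; rewrite ge_min lexx => /(_ isT wr); rewrite ler_norml => /andP[]; lra.
have {F0} : \int[mu]_x (u x * mollifier y r x) <= (u y + e / 2) * moll_mass r.
  rewrite -(Rintegral_moll y r0) -RintegralZl//; last exact: integrable_moll1.
  rewrite -[leLHS]addr0 -[X in _ + X <= _](mul0r (moll_mass r)); apply: F0 => w wr; rewrite addr0.
  have := h2 r w; rewrite ge_min lexx orbT => /(_ isT wr); rewrite ler_norml => /andP[]; lra.
have := mollification_lip y v uW Du1 r0 ltr01.
rewrite scale1r scale0r addr0 subr0 mulr1.
have := moll_mass_gt0 r0; rewrite (addrC v).
move: (moll_mass r) (\int[mu]_x (u x * mollifier (y + v) r x)) (\int[mu]_x (u x * mollifier y r x)).
move=> c I1 I0 c0 A B C; rewrite -(ler_pM2r c0).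
move: (u y) (u (y + v)) (enorm v) A B C => p q w A B C; lra.
Qed.

End mollification.

(** * Absolute continuity of the integral *)

Section absolute_continuity.
Context d (T : measurableType d) (R : realType) (mu : {measure set T -> \bar R}).
Local Open Scope ereal_scope.

(** The function may take the value +oo; it is replaced by its finite part,
    from which it differs on a null set only. *)
Lemma integral_small_set (K : set T) (f : T -> \bar R) (eps : R) :
  measurable K -> mu.-integrable K f -> (forall x, 0 <= f x) -> (0 < eps)%R ->
  exists2 dl : R, (0 < dl)%R & forall A, measurable A -> A `<=` K ->
    mu A < dl%:E -> \int[mu]_(x in A) f x < eps%:E.
Proof.
move=> mK fi f0 e0; pose g x := fine ((f \_ K) x).
have fKi : mu.-integrable setT (f \_ K) by apply/(integrable_mkcond f mK).
have gi : mu.-integrable setT (EFin \o g).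
  apply: (le_integrable measurableT _ _ fKi).
    apply/measurable_EFinP; apply: (@measurableT_comp _ _ _ _ _ _ fine); first exact: fine_measurable.
    exact: measurable_int fKi.
  move=> x _; rewrite /g /=; case: ((f \_ K) x) => [r||] //=; rewrite normr0 leey//.
have [dl [dl0 H]] := integral_normr_continuous gi e0.
exists dl => // A mA AK Adl; have {}H := H A mA Adl.
have giA : mu.-integrable A (EFin \o g) by exact: integrableS gi.
have -> : \int[mu]_(x in A) f x = \int[mu]_(x in A) `|(EFin \o g) x|.
  apply: ae_eq_integral => //.
  - apply: measurable_funS (measurable_int _ fi) => //.
  - by apply: measurableT_comp => //; exact: measurable_int giA.
  have := integrable_ae mK fi; apply: filterS => x fx Ax.
  have fin := fx (AK _ Ax).
  have gE : g x = fine (f x) by rewrite /g /patch mem_set//; exact: AK.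
  by rewrite /= gE ger0_norm ?fine_ge0// fineK.
rewrite -[ltLHS]fineK; first by rewrite lte_fin.
apply: integrable_fin_num => //; exact: integrable_abse.
Qed.
End absolute_continuity.

(** * Energy around a light segment *)

Section light.
Context (R : realType) (n : nat).
Implicit Types (u : 'rV[R]_n -> R) (Du : 'rV[R]_n -> 'rV[R]_n).
Implicit Types (x y z e w : 'rV[R]_n) (l r d s t q dl : R).
Local Notation mu := (lebesgue_rV R n).

(** A light segment with the orientation in which u increases, as an origin, a
    unit direction and a length. *)
Definition light_ray u x e l :=
  [/\ enorm e = 1, 0 < l & u (x + l *: e) = u x + l].

Definition lipschitz1 u := forall x y, u x - u y <= enorm (x - y).

(** Both ends of the ray pinch u: the Lipschitz bound from the origin limits u
    near the point of parameter s from above, the one from the far end limits u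
    near the point of parameter t from below. The first-order terms in the
    displacement w cancel between the two bounds, which leaves an error
    quadratic in w. *)
Lemma light_ray_gain u x e l d s t w : lipschitz1 u -> light_ray u x e l ->
  0 < d -> d <= s -> t <= l - d ->
  u (w + (x + s *: e)) + (t - s - enorm w ^+ 2 / d) <= u (w + (x + t *: e)).
Proof.
move=> ul [e1 l0 ue] d0 ds tl.
have s0 : 0 < s by exact: lt_le_trans ds.
have t0 : 0 < l - t by lra.
have h1 := ul (w + (x + s *: e)) x.
have h2 := ul (x + l *: e) (w + (x + t *: e)).
rewrite (_ : w + _ - x = s *: e + w) in h1; last first.
  by rewrite addrC (addrC w) !addrA addNr add0r.
rewrite (_ : x + _ - _ = (l - t) *: e + - w) in h2; last first.
  by apply/rowP => i; rewrite !mxE; ring.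
have g1 := enorm_offset w e1 s0; have g2 := enorm_offset (- w) e1 t0.
rewrite dotNr enormN in g2.
have k (y : R) : d <= y -> enorm w ^+ 2 / (2 * y) <= enorm w ^+ 2 / d / 2.
  move=> dy; rewrite -mulrA ler_wpM2l ?sqr_ge0// -invfM lef_pV2 ?posrE ?mulr_gt0//; lra.
have ks := k s ds; have {k}kt : enorm w ^+ 2 / (2 * (l - t)) <= enorm w ^+ 2 / d / 2 by apply: k; lra.
move: (enorm w ^+ 2 / d) (enorm w ^+ 2 / (2 * s)) (enorm w ^+ 2 / (2 * (l - t))) ks kt g1 g2 h1 h2.
by move=> *; lra.
Qed.

Definition slope_deficit Du a e r := moll_mass n r - \int[mu]_x (dot (Du x) e * mollifier a r x).

(** Over the parameter interval from s to s + 2 N dl, the mollification of u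
    gains, per unit of mass, that length up to an error n r^2 / d. Its slope is
    at most 1, so the total deficit of slope is bounded by the error. The points tau
    come from the mean value theorem on every second subinterval of length dl,
    which keeps them at mutual distance more than dl. *)
Lemma sum_slope_deficit_le u Du x e l d r s dl N :
  W1infty_loc u Du -> weakly_spacelike Du -> lipschitz1 u -> light_ray u x e l ->
  0 < d -> 0 < r -> 0 < dl -> d <= s -> s + (2 * N)%:R * dl <= l - d ->
  exists tau : nat -> R,
   (forall k, s + (2 * k)%:R * dl < tau k < s + (2 * k).+1%:R * dl) /\
   dl * \sum_(k < N) slope_deficit Du (x + tau k *: e) e r <= moll_mass n r * (n%:R * r ^+ 2 / d).
Proof.
move=> uW Du1 ul ray d0 r0 dl0 ds sN.
have [e1 l0 ue] := ray.
pose F t := \int[mu]_y (u y * mollifier (x + t *: e) r y).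
pose S k := s + (2 * k)%:R * dl.
have SS k : s + (2 * k).+1%:R * dl = S k + dl by rewrite /S -addn1 natrD; ring.
have SS2 k : S k.+1 = S k + dl + dl by rewrite /S mulnS natrD; ring.
have lt1 k : S k < S k + dl by rewrite ltrDl.
have /choice[tau htau] k : exists c, S k < c < S k + dl /\
    F (S k + dl) - F (S k) = \int[mu]_y (dot (Du y) e * mollifier (x + c *: e) r y) * dl.
  have [c h E] := mollification_MVT x e uW r0 (lt1 k).
  have eS : S k + dl - S k = dl by rewrite addrAC subrr add0r.
  by rewrite eS in E; exists c; split; [exact: h|exact: E].
exists tau; split => [k|]; first by rewrite SS; case: (htau k).
have step : dl * \sum_(k < N) slope_deficit Du (x + tau k *: e) e r <=
    moll_mass n r * (S N - s) - (F (S N) - F s).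
  elim: {sN} N => [|N IH].
    by rewrite big_ord0 /S muln0 mul0r addr0 !subrr !mulr0.
  rewrite big_ord_recr /= mulrDr SS2.
  have lt2 : S N + dl < S N + dl + dl by rewrite ltrDl.
  have h : F (S N + dl + dl) - F (S N + dl) <= moll_mass n r * dl.
    have := mollification_lip x e uW Du1 r0 lt2.
    by rewrite e1 mul1r (_ : S N + dl + dl - (S N + dl) = dl)//; ring.
  have [_ h'] := htau N; rewrite {2}/slope_deficit.
  move: (\int[mu]_y (dot (Du y) e * mollifier (x + tau N *: e) r y)) h h' IH => D.
  move: (F (S N)) (F s) (F (S N + dl)) (F (S N + dl + dl)) => F1 F2 F3 F4.
  move: (S N) (moll_mass n r) (\sum_(k < N) _) => SN c Sg h h' IH; clear -h h' IH; lra.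
apply: (le_trans step).
have := @moll_le_shift R n u u (x + s *: e) (x + S N *: e) r (S N - s - n%:R * r ^+ 2 / d) r0 uW.1 uW.1.
move=> h; suff : F s + (S N - s - n%:R * r ^+ 2 / d) * moll_mass n r <= F (S N).
  move: (F s) (F (S N)) (moll_mass n r) (n%:R * r ^+ 2 / d) (S N) => F1 F2 c k SN H.
  clear -H; lra.
apply: h => w wr; apply: le_trans (light_ray_gain w ul ray d0 ds sN).
rewrite lerD2l lerD2l lerN2 ler_wpM2r ?invr_ge0 ?(ltW d0)//.
by apply: enorm_le_cube => //; exact: ltW.
Qed.

(** Integrals of this function are called energies below. *)
Local Notation hq Du q := (fun x => (lorentz_factor (Du x) `^ q)%E).

(** A substitute for the convexity of P^(-q/2) in P = 1 - p.e: the right-hand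
    side is negative for P > a, and for P < a one has 1 - |p|^2 <= 2 P < 2 a. *)
Lemma lorentz_ge (p e : 'rV[R]_n) (a q : R) : enorm e = 1 -> 0 < a -> 0 < q ->
  (((2 * a) `^ (- (q / 2)) * (1 - (1 - dot p e) / a))%:E <= lorentz_factor p `^ q)%E.
Proof.
move=> e1 a0 q0.
have [aP|Pa] := leP a (1 - dot p e).
  apply: (@le_trans _ _ 0%E); last exact: poweR_ge0.
  by rewrite lee_fin mulr_ge0_le0 ?powR_ge0// subr_le0 ler_pdivlMr// mul1r.
rewrite /lorentz_factor; case: ifPn => [p1|_]; last by rewrite poweRyr ?leey// gt_eqF.
have dp : dot p e <= enorm p by have := dot_le p e; rewrite e1 mulr1.
have P0 : 0 <= 1 - dot p e by rewrite subr_ge0 (le_trans dp)// ltW.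
set y := 1 - enorm p ^+ 2.
have p0 := enorm_ge0 p.
have y0 : 0 < y by rewrite /y; nra.
have ya : y <= 2 * a by rewrite /y; nra.
rewrite poweR_EFin lee_fin; apply: (@le_trans _ _ ((2 * a) `^ (- (q / 2)))).
  by rewrite ler_piMr ?powR_ge0// gerBl divr_ge0// ltW.
rewrite (_ : - (q / 2) = - 2^-1 * q); last by ring.
rewrite powRrM ge0_ler_powR ?nnegrE ?powR_ge0 ?invr_ge0 ?sqrtr_ge0 ?(ltW q0)//.
have a2 : 0 < 2 * a by rewrite mulr_gt0.
rewrite powRN powR12_sqrt ?(ltW a2)// lef_pV2 ?posrE ?sqrtr_gt0//.
by rewrite ler_wsqrtr.
Qed.

(** Integrated against a weight psi with values in [0, 1]. With a chosen as twice
    the mean of 1 - Du.e, the right-hand side is half the mass of psi times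
    (2 a)^(-q/2), as Jensen's inequality would give up to a constant. *)
Lemma energy_ge Du e (a q : R) (T : set 'rV[R]_n) (psi : 'rV[R]_n -> R) :
  enorm e = 1 -> 0 < a -> 0 < q -> measurable T ->
  mu.-integrable T (hq Du q) ->
  (forall x, 0 <= psi x) -> (forall x, psi x <= \1_T x) ->
  mu.-integrable setT (EFin \o psi) ->
  mu.-integrable setT (EFin \o (fun x => dot (Du x) e * psi x)) ->
  (((2 * a) `^ (- (q / 2)) * (\int[mu]_x psi x -
     (\int[mu]_x psi x - \int[mu]_x (dot (Du x) e * psi x)) / a))%:E <=
   \int[mu]_(x in T) hq Du q x)%E.
Proof.
move=> e1 a0 q0 mT hi psi0 psi1 pi di.
set M := _ `^ _.
pose g x := M * (psi x - (psi x - dot (Du x) e * psi x) / a).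
have pdi : mu.-integrable setT (EFin \o (fun x => (psi x - dot (Du x) e * psi x) / a)).
  exact: (integrableZr measurableT a^-1 (integrableB measurableT pi di)).
have ppi : mu.-integrable setT (EFin \o (fun x => psi x - (psi x - dot (Du x) e * psi x) / a)).
  exact: (integrableB measurableT pi pdi).
have gi : mu.-integrable setT (EFin \o g) by exact: (integrableZl measurableT M ppi).
have -> : M * (\int[mu]_x psi x - (\int[mu]_x psi x - \int[mu]_x (dot (Du x) e * psi x)) / a)
    = \int[mu]_x g x.
  rewrite RintegralZl// RintegralB// RintegralZr ?RintegralB//.
  exact: (integrableB measurableT pi di).
have gT x : ~ T x -> g x = 0.
  move=> Tx; have p0 : psi x = 0.
    by apply/eqP; rewrite eq_le psi0 andbT (le_trans (psi1 x))// indicE memNset.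
  by rewrite /g p0 !(mulr0, subrr, mul0r).
have giT : mu.-integrable T (EFin \o g) by exact: integrableS gi.
have -> : (\int[mu]_x g x)%:E = (\int[mu]_(x in T) (g x)%:E)%E.
  rewrite /Rintegral fineK; last exact: integrable_fin_num.
  rewrite [RHS]integral_mkcond; apply: eq_integral => x _; rewrite /patch.
  by case: ifPn => // /negP; rewrite inE => /gT ->.
apply: le_integral => // x; rewrite inE => Tx.
have c1 : psi x <= 1 by rewrite (le_trans (psi1 x))// indicE mem_set.
have := lorentz_ge (Du x) e1 a0 q0; rewrite -/M /= /g.
rewrite (_ : psi x - _ / a = (1 - (1 - dot (Du x) e) / a) * psi x); last by ring.
set Q := 1 - _ / a; have [Q0|/ltW Q0] := leP 0 Q; last first.
  move=> _; apply: (@le_trans _ _ 0%E); last exact: poweR_ge0.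
  by rewrite lee_fin mulr_ge0_le0 ?powR_ge0// mulr_le0_ge0.
by apply: le_trans; rewrite lee_fin ler_wpM2l ?powR_ge0// ler_piMr.
Qed.

(** The weight is the sum of N mollifiers centred on the ray at the points tau.
    The coordinate i, in which the direction e does not vanish, separates the
    cubes that carry them, so the sum is at most 1. *)
Lemma tube_energy u Du x e l d r s dl N q (i : 'I_n) :
  W1infty_loc u Du -> weakly_spacelike Du -> lipschitz1 u -> light_ray u x e l ->
  0 < q -> L1_loc (hq Du q) ->
  0 < d -> 0 < r -> 0 < dl -> d <= s -> s + (2 * N)%:R * dl <= l - d -> (0 < N)%N ->
  2 * r <= dl * `|e ord0 i| ->
  exists tau : nat -> R,
   (forall k, (k < N)%N -> s < tau k < s + (2 * N)%:R * dl) /\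
   (((4 * (n%:R * r ^+ 2 / d) / (dl * N%:R)) `^ (- (q / 2)) * (N%:R * moll_mass n r / 2))%:E <=
    \int[mu]_(y in \big[setU/set0]_(k < N) cube (x + tau k *: e)%R r) hq Du q y)%E.
Proof.
move=> uW Du1 ul ray q0 hL d0 r0 dl0 ds sN N0 ri.
have n0 : (0 < n)%N by exact: leq_trans (ltn_ord i).
have [e1 l0 ue] := ray.
have [tau [htau tdef]] := sum_slope_deficit_le uW Du1 ul ray d0 r0 dl0 ds sN.
have tlt k : (k < N)%N -> s < tau k < s + (2 * N)%:R * dl.
  move=> kN; have /andP[t1 t2] := htau k; apply/andP; split.
    by apply: le_lt_trans t1; rewrite lerDl mulr_ge0// ltW.
  apply: (lt_le_trans t2); rewrite lerD2l ler_wpM2r ?(ltW dl0)// ler_nat.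
  by rewrite ltn_mul2l.
exists tau; split=> //.
pose T := \big[setU/set0]_(k < N) cube (x + tau k *: e) r.
have mT : measurable T by apply: bigsetU_measurable => k _; exact: measurable_cube.
have TE : T = \bigcup_(k < N) cube (x + tau k *: e) r.
  exact: esym (bigcup_mkord N (fun k => cube (x + tau k *: e) r)).
have Nr0 : 0 < N%:R :> R by rewrite ltr0n.
pose V := \sum_j `|e ord0 j|.
pose rho := r + (s + (2 * N)%:R * dl) * V.
have s0 : 0 < s by exact: lt_le_trans ds.
have Trho : T `<=` cube x rho.
  rewrite TE => y [k /= kN /cube_shift yk] j.
  apply: le_trans (yk j) _; rewrite lerD2l ler_wpM2r ?sumr_ge0//.
  have /andP[t1 t2] := tlt k kN; rewrite gtr0_norm ?ltW//; exact: lt_trans t1.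
have hT : mu.-integrable T (hq Du q).
  by apply: integrableS (hL _ (@compact_cube R n x rho)) => //; exact: measurable_cube.
pose psi y := \sum_(k < N) mollifier (x + tau k *: e) r y.
have psi0 y : 0 <= psi y by apply: sumr_ge0 => k _; exact: moll_ge0.
have disj (j k : 'I_N) y : cube (x + tau j *: e) r y -> cube (x + tau k *: e) r y -> j = k.
  wlog jk : j k / (j <= k)%N.
    move=> W; have [/W//|/ltnW/W h] := leqP j k; move=> ? ?; exact/esym/h.
  move=> yj yk; apply/val_inj/eqP; rewrite eqn_leq jk/= leqNgt; apply/negP => {}jk.
  have := yj i; have := yk i; rewrite !mxE => h1 h2.
  have h3 : `|(tau k - tau j) * e ord0 i| <= 2 * r.
    rewrite (_ : (_ - _) * _ = (y ord0 i - (x ord0 i + tau j * e ord0 i)) -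
      (y ord0 i - (x ord0 i + tau k * e ord0 i))); last by ring.
    by apply: le_trans (ler_normB _ _) _; rewrite mulr2n mulrDl mul1r lerD.
  have h4 : dl < tau k - tau j.
    have /andP[_ t1] := htau j; have /andP[t2 _] := htau k.
    have : ((2 * j).+2)%:R * dl <= (2 * k)%:R * dl.
      by rewrite ler_wpM2r ?(ltW dl0)// ler_nat !mul2n -doubleS leq_double.
    move: t1 t2; rewrite -[(2 * j).+2]addn2 -[(2 * j).+1]addn1 !natrD.
    by move: (j%:R : R) (k%:R : R) (tau j) (tau k) => A B C D; clear; lra.
  have ei : 0 < `|e ord0 i|.
    rewrite normr_gt0; apply/eqP => ei0; move: ri; rewrite ei0 normr0 mulr0; lra.
  move: h3; rewrite normrM gtr0_norm; last by apply: lt_trans h4.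
  by apply/negP; rewrite -ltNge (le_lt_trans ri)// ltr_pM2r.
have psi1 y : psi y <= \1_T y.
  rewrite indicE; case: (boolP (y \in T)) => [yT|/negP yT].
    have := yT; rewrite inE TE => -[k0 /= k0N yk0].
    rewrite /psi (bigD1 (Ordinal k0N))//= big1 ?addr0 ?moll_le1// => k kk0.
    rewrite moll_out// => yk; move/eqP: kk0; apply; exact: (disj _ (Ordinal k0N) y).
  rewrite /psi big1// => k _; rewrite moll_out// => yk; apply: yT.
  by rewrite inE TE; exists k => //=.
have [ipsi Ipsi] := @Rintegral_sum _ _ _ mu _ (index_enum 'I_N) (fun k y => mollifier (x + tau k *: e) r y)
   (fun k => integrable_moll1 _ r0).
have dL := Linfty_loc_dot e uW Du1.
have [idpsi Idpsi] := @Rintegral_sum _ _ _ mu _ (index_enum 'I_N)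
   (fun k y => dot (Du y) e * mollifier (x + tau k *: e) r y)
   (fun k => integrable_moll _ r0 dL).
have dpsiE : (fun y => dot (Du y) e * psi y) =
    (fun y => \sum_(k < N) dot (Du y) e * mollifier (x + tau k *: e) r y).
  by apply/funext => y; rewrite /psi mulr_sumr.
have n0' : 0 < n%:R :> R by rewrite ltr0n.
have b0 : 0 < n%:R * r ^+ 2 / d by rewrite divr_gt0// mulr_gt0// exprn_gt0.
have a0 : 0 < 2 * (n%:R * r ^+ 2 / d) / (dl * N%:R).
  by apply: divr_gt0; exact: mulr_gt0.
have := @energy_ge Du e _ q T psi e1 a0 q0 mT hT psi0 psi1 ipsi.
rewrite dpsiE => /(_ idpsi); apply: le_trans.
rewrite lee_fin (_ : 2 * (2 * _ / _) = 4 * (n%:R * r ^+ 2 / d) / (dl * N%:R)); last by ring.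
rewrite ler_wpM2l ?powR_ge0//.
have S1 : \sum_(k < N) \int[mu]_y mollifier (x + tau k *: e) r y = N%:R * moll_mass n r.
  rewrite (eq_bigr (fun=> moll_mass n r)) => [|k _]; last exact: Rintegral_moll.
  by rewrite sumr_const card_ord mulr_natl.
have S2 : \sum_(k < N) \int[mu]_y (dot (Du y) e * mollifier (x + tau k *: e) r y) =
    N%:R * moll_mass n r - \sum_(k < N) slope_deficit Du (x + tau k *: e) e r.
  rewrite mulr_natl -[in X in _ *+ X](card_ord N) -sumr_const -sumrB.
  by apply: eq_bigr => k _; rewrite subKr.
rewrite Idpsi Ipsi S1 S2 subKr.
have c0 := moll_mass_gt0 n r0.
move: (moll_mass n r) c0 (\sum_(k < N) _) tdef => c c0 Sg tdef.
set b := n%:R * r ^+ 2 / d in tdef a0 b0 *.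
rewrite lerBrDr -lerBrDl ler_pdivrMr//.
rewrite (_ : (_ - _) * _ = c * b / dl); last by field; rewrite !gt_eqF.
by rewrite ler_pdivlMr// mulrC.
Qed.

Lemma hq_ge0 Du q x : (0 <= lorentz_factor (Du x) `^ q)%E.
Proof. exact: poweR_ge0. Qed.

Lemma light_ray_coord u x e l : light_ray u x e l -> exists i, 0 < `|e ord0 i|.
Proof.
move=> [e1 _ _]; apply/not_existsP => h.
have e0 : e = 0.
  by apply/rowP => i; rewrite mxE; apply/eqP; rewrite -normr_le0 leNgt; apply/negP/h.
by move: e1; rewrite e0 -(scale0r 0) enormZ normr0 mul0r => /esym/eqP; rewrite oner_eq0.
Qed.

(** A chain of N disjoint cubes of radius r along half of the ray, with N r
    constant, has energy bounded below when q >= n - 1, while its measure is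
    O(r^(n-1)). *)
Lemma no_light_ray u Du q x e l : (2 <= n)%N ->
  W1infty_loc u Du -> weakly_spacelike Du -> lipschitz1 u ->
  L1_loc (hq Du q) -> 1 <= q -> n%:R - 1 <= q -> ~ light_ray u x e l.
Proof.
move=> n2 uW Du1 ul hL q1 nq ray; have [e1 l0 _] := ray.
have [i m0] := light_ray_coord ray; set m := `|e ord0 i| in m0.
have q0 : 0 < q by lra.
have n0 : (0 < n)%N by rewrite (leq_trans _ n2).
have nR0 : 0 < n%:R :> R by rewrite ltr0n.
have low0 := moll_low_gt0 R n.
pose V := \sum_j `|e ord0 j|.
pose K := cube x (1 + l * V).
pose kap := (64 * n%:R / l ^+ 2) `^ (- (q / 2)) * (m * l / 16) * moll_low R n.
have kap0 : 0 < kap.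
  by rewrite !mulr_gt0 ?invr_gt0// powR_gt0// divr_gt0 ?mulr_gt0// exprn_gt0.
have [dl dl0 small] := integral_small_set (@measurable_cube R n x (1 + l * V))
  (hL K (@compact_cube _ _ _ _)) (hq_ge0 Du q) kap0.
(* N is chosen so that r <= 1 and so that the union has measure less than dl. *)
pose X := Num.max (m * l / 8) (2 ^+ n * (m * l / 8) ^+ 2 / dl).
have X0 : 0 <= X by rewrite le_max divr_ge0// mulr_ge0 ?ltW.
pose N := Num.bound X.
have XN : X < N%:R by exact: archi_boundP.
have N0R : 0 < N%:R :> R by exact: le_lt_trans XN.
have N0 : (0 < N)%N by rewrite -(ltr0n R).
(* Half of the ray is cut into 2 N pieces of length h = l / (4 N), and r is the
   largest radius for which coordinate i separates cubes at distance h. *)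
pose r := m * l / (8 * N%:R).
have r0 : 0 < r by rewrite divr_gt0 ?mulr_gt0.
have Nr : N%:R = m * l / (8 * r) by rewrite /r; field; rewrite !gt_eqF.
have r1 : r <= 1.
  move: XN; rewrite gt_max => /andP[+ _]; rewrite /r ler_pdivrMr ?mulr_gt0//; lra.
have rdl : N%:R * (2 * r) ^+ n < dl.
  have rn : r ^+ n <= r ^+ 2 by rewrite ler_wiXn2l// ltW.
  rewrite exprMn mulrCA; apply: (@le_lt_trans _ _ (N%:R * (2 ^+ n * r ^+ 2))).
    by rewrite mulrCA ler_wpM2l ?(ltW N0R)// ler_wpM2l// exprn_ge0.
  move: XN; rewrite gt_max => /andP[_].
  rewrite (_ : N%:R * _ = 2 ^+ n * (m * l / 8) ^+ 2 / N%:R).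
    by rewrite ltr_pdivrMr// => XN; rewrite ltr_pdivrMr// (mulrC dl).
  by rewrite /r; field; rewrite !gt_eqF.
pose h := l / (4 * N%:R).
have h0 : 0 < h by rewrite divr_gt0// mulr_gt0.
have d0 : 0 < l / 4 by rewrite divr_gt0.
have hN : l / 4 + (2 * N)%:R * h = l - l / 4.
  by rewrite /h natrM; field; rewrite gt_eqF.
have hle : l / 4 + (2 * N)%:R * h <= l - l / 4 by rewrite hN.
have rh : 2 * r <= h * m.
  by rewrite /r /h (_ : 2 * _ = l / (4 * N%:R) * m)//; field; rewrite gt_eqF.
have [tau [tauP]] := tube_energy uW Du1 ul ray q0 hL d0 r0 h0 (lexx _) hle N0 rh.
apply/negP; rewrite -ltNge.
set U := \big[setU/set0]_(k < N) _.
have mU : measurable U by apply: bigsetU_measurable => k _; exact: measurable_cube.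
apply: (@lt_le_trans _ _ kap%:E).
  apply: small => //.
    rewrite /U -(bigcup_mkord N (fun k => cube (x + tau k *: e) r)) => y [k /= kN /cube_shift yk] j.
    apply: le_trans (yk j) _; apply: lerD => //; rewrite ler_wpM2r ?sumr_ge0//.
    have /andP[t1 t2] := tauP k kN; rewrite hN in t2; rewrite gtr0_norm; lra.
  apply: le_lt_trans (_ : ((N%:R * (2 * r) ^+ n)%:E < dl%:E)%E); last by rewrite lte_fin.
  apply: le_trans (Boole_inequality mu (A := fun k => cube (x + tau k *: e) r) _) _.
    by move=> k _; exact: measurable_cube.
  rewrite (eq_bigr (fun=> ((2 * r) ^+ n)%:E)) => [|k _]; last first.
    exact: (lebesgue_cube (x + tau k *: e) (ltW r0)).
  by rewrite sumEFin sumr_const card_ord -[_ *+ N]mulr_natl.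
rewrite lee_fin.
have -> : 4 * (n%:R * r ^+ 2 / (l / 4)) / (h * N%:R) = 64 * n%:R / l ^+ 2 * r ^+ 2.
  by rewrite /h; field; rewrite !gt_eqF.
have pe : (r ^+ 2) `^ (- (q / 2)) = r `^ (- q).
  rewrite -powR_mulrn ?(ltW r0)// -powRrM; congr (_ `^ _); by field.
have c640 : 0 <= 64 * n%:R / l ^+ 2 by apply: divr_ge0; [exact: mulr_ge0|exact: sqr_ge0].
rewrite powRM ?sqr_ge0// pe.
rewrite /kap -!mulrA ler_wpM2l ?powR_ge0//.
have mass := moll_mass_ge n r0.
apply: (@le_trans _ _ (r `^ (- q) * (N%:R * (moll_low R n * r ^+ n / 2)))); last first.
  rewrite ler_wpM2l ?powR_ge0// ler_wpM2l ?(ltW N0R)//; lra.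
have -> : r `^ (- q) * (N%:R * (moll_low R n * r ^+ n / 2)) =
   m * (l * (16^-1 * moll_low R n)) * (r `^ (- q) * r ^+ n / r).
  by rewrite Nr; field; rewrite gt_eqF.
rewrite ler_peMr ?mulr_ge0 ?invr_ge0 ?(ltW m0) ?(ltW l0) ?(ltW low0)//.
rewrite -powR_mulrn ?(ltW r0)// -powR_inv1 ?(ltW r0)//.
rewrite -!powRD ?(gt_eqF r0) ?implybT//.
rewrite -[leLHS](powRr0 r) ger_powR ?r0//; lra.
Qed.

(** A single cube of radius comparable to rho. The constants depend on the ray
    through its length and through a nonzero coordinate of its direction; they
    are made uniform later, by splitting into countably many sets. *)
Lemma light_ray_density u Du q x e l :
  W1infty_loc u Du -> weakly_spacelike Du -> lipschitz1 u ->
  L1_loc (hq Du q) -> 0 < q -> light_ray u x e l ->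
  exists2 kap, 0 < kap & exists2 rho0, 0 < rho0 & forall rho, 0 < rho -> rho < rho0 ->
    ((kap * rho `^ (n%:R - q / 2))%:E <=
     \int[mu]_(y in cube (x + (l / 2) *: e)%R rho) hq Du q y)%E.
Proof.
move=> uW Du1 ul hL q0 ray; have [e1 l0 _] := ray.
have [i m0] := light_ray_coord ray; set m := `|e ord0 i| in m0.
have n0 : (0 < n)%N by exact: leq_trans (ltn_ord i).
have nR0 : 0 < n%:R :> R by rewrite ltr0n.
have low0 := moll_low_gt0 R n.
pose V := \sum_j `|e ord0 j|.
have V0 : 0 <= V by exact: sumr_ge0.
(* The cube of radius r around any admissible centre on the ray lies in the cube of
   radius C r around the midpoint. *)
pose C := 1 + 2 / m * V.
have C0 : 0 < C by rewrite ltr_pwDl// mulr_ge0// divr_ge0// ltW.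
pose c := 8 * n%:R * m / l.
have c0 : 0 < c by rewrite divr_gt0 ?mulr_gt0.
pose s := n%:R - q / 2.
exists (c `^ (- (q / 2)) * (moll_low R n / 2) * C^-1 `^ s).
  apply: mulr_gt0; last by rewrite powR_gt0// invr_gt0.
  by apply: mulr_gt0; [exact: powR_gt0|exact: divr_gt0].
exists (C * (m * l / 8)); first by rewrite mulr_gt0// divr_gt0 ?mulr_gt0.
move=> rho rho0 rholt; pose r := rho / C.
have r0 : 0 < r by rewrite divr_gt0.
have rC : rho = r * C by rewrite /r divfK// gt_eqF.
have rlt : r < m * l / 8 by rewrite /r ltr_pdivrMr// mulrC.
pose h := 2 * r / m.
have h0 : 0 < h by rewrite divr_gt0// mulr_gt0.
have hm : 2 * r <= h * `|e ord0 i| by rewrite -/m /h divfK// gt_eqF.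
have hl : h < l / 4.
  by rewrite /h ltr_pdivrMr//; lra.
have d0 : 0 < l / 4 by rewrite divr_gt0.
have ds : l / 4 <= l / 2 - h by lra.
have sl : l / 2 - h + (2 * 1)%:R * h <= l - l / 4 by rewrite muln1; lra.
have [tau [/(_ 0 isT)/andP[t1 t2]]] := tube_energy uW Du1 ul ray q0 hL d0 r0 h0 ds sl isT hm.
rewrite big_ord_recl big_ord0 setU0 /= mulr1 mul1r => E.
apply: (@le_trans _ _ (\int[mu]_(y in cube (x + tau 0 *: e)%R r) hq Du q y)%E); last first.
  have zE : x + tau 0 *: e = (x + (l / 2) *: e) + (tau 0 - l / 2) *: e.
    by apply/rowP => j; rewrite !mxE; ring.
  apply: ge0_subset_integral; [exact: measurable_cube|exact: measurable_cube| | |].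
  - exact: measurable_int (hL _ (@compact_cube R n _ _)).
  - by move=> y _; exact: poweR_ge0.
  rewrite zE => y /cube_shift yk j; apply: le_trans (yk j) _.
  rewrite rC /C mulrDr mulr1 lerD2l.
  rewrite (_ : r * _ = h * V); last by rewrite /h; ring.
  rewrite ler_wpM2r// ler_norml; move: t1 t2; rewrite muln1; lra.
apply: le_trans E; rewrite lee_fin.
have -> : 4 * (n%:R * r ^+ 2 / (l / 4)) / h = c * r.
  by rewrite /c /h; field; rewrite !gt_eqF.
rewrite (powRM _ (ltW c0) (ltW r0)) -/s.
rewrite -[leLHS]mulrA -(powRM _ _ (ltW rho0)) ?invr_ge0 ?(ltW C0)//.
rewrite (_ : C^-1 * rho = r); last by rewrite mulrC.
have rs : r `^ s = r `^ (- (q / 2)) * r ^+ n.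
  rewrite -powR_mulrn ?(ltW r0)// -powRD ?(gt_eqF r0) ?implybT//.
  by rewrite addrC.
rewrite rs -!mulrA ler_wpM2l ?powR_ge0//.
rewrite (_ : moll_low R n * _ = r `^ (- (q / 2)) * (moll_low R n * r ^+ n / 2)); last by ring.
rewrite ler_wpM2l ?powR_ge0//.
have := moll_mass_ge n r0; lra.
Qed.
End light.

(** * Covering by cubes of large energy *)

Section covering.
Context (R : realType) (n : nat).
Implicit Types (A B : set 'rV[R]_n) (x y z : 'rV[R]_n) (r s rho : R) (t : seq 'rV[R]_n).
Local Notation mu := (lebesgue_rV R n).

Definition cubes r t : set 'rV[R]_n := \big[setU/set0]_(z <- t) cube z r.

(** Pairwise disjointness of the cubes of radius r with centres in t. *)
Definition separated r t := pairwise (fun a b => ~~ `[< cube b (2 * r) a >]) t.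

Lemma measurable_cubes r t : measurable (cubes r t).
Proof. by apply: bigsetU_measurable => z _; exact: measurable_cube. Qed.

Lemma cubesP r t y : cubes r t y <-> exists2 z, z \in t & cube z r y.
Proof.
rewrite /cubes -bigcup_seq; split => [[z /= zt zy]|[z zt zy]]; exists z => //=.
Qed.

Lemma lebesgue_cubes_le r t : 0 <= r ->
  (mu (cubes r t) <= ((size t)%:R * (2 * r) ^+ n)%:E)%E.
Proof.
move=> r0; elim: t => [|z t IH]; first by rewrite /cubes big_nil measure0 mul0r.
have -> : cubes r (z :: t) = cube z r `|` cubes r t by rewrite /cubes big_cons.
have mz := @measurable_cube R n z r; have mt := measurable_cubes r t.
apply: le_trans (measureU2 _ mz mt) _.
rewrite [size _]/= -addn1 natrD addrC mulrDl mul1r EFinD; apply: leeD => //.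
by rewrite -(lebesgue_cube z r0).
Qed.

Lemma integral_cubes_ge (f : 'rV[R]_n -> \bar R) r t (c : R) (K : set 'rV[R]_n) :
  measurable K -> measurable_fun K f -> (forall x, 0 <= f x)%E ->
  separated r t -> (forall z, z \in t -> cube z r `<=` K) ->
  (forall z, z \in t -> (c%:E <= \int[mu]_(x in cube z r) f x)%E) ->
  (((size t)%:R * c)%:E <= \int[mu]_(x in cubes r t) f x)%E.
Proof.
move=> mK mf f0; elim: t => [|z t IH]; first by rewrite /cubes big_nil integral_set0 mul0r.
rewrite /separated pairwise_cons => /andP[/allP zt st] tK tc.
have tK' : forall z, z \in t -> cube z r `<=` K by move=> a at_; apply: tK; rewrite inE at_ orbT.
have mU : measurable_fun (cube z r `|` cubes r t) f.
  apply: measurable_funS mf => // y [zy|/cubesP[a at_ ay]].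
    by apply: (tK z) zy; rewrite mem_head.
  exact: tK' at_ _ ay.
have -> : cubes r (z :: t) = cube z r `|` cubes r t by rewrite /cubes big_cons.
rewrite ge0_integral_setU//.
- rewrite [size _]/= -addn1 natrD addrC mulrDl mul1r EFinD; apply: leeD.
    by apply: tc; rewrite mem_head.
  by apply: IH => // a at_; apply: tc; rewrite inE at_ orbT.
- exact: measurable_cube.
- exact: measurable_cubes.
- rewrite disj_set2E; apply/eqP/seteqP; split => // y [zy /cubesP[a at_ ay]].
  have /negP := zt a at_; apply; apply/asboolP => i.
  rewrite (_ : z ord0 i - a ord0 i = (y ord0 i - a ord0 i) - (y ord0 i - z ord0 i)); last by ring.
  by apply: le_trans (ler_normB _ _) _; rewrite mulr2n mulrDl mul1r lerD.
Qed.

(** Doubling the radius of a maximal family of disjoint cubes gives a cover, since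
    a point left uncovered could be added to the family. *)
Lemma maximal_separated A r (M : nat) :
  (forall t, {in t, forall z, A z} -> separated r t -> (size t <= M)%N) ->
  exists t, [/\ {in t, forall z, A z}, separated r t & A `<=` cubes (2 * r) t].
Proof.
move=> bnd.
pose P k := `[< exists t, [/\ {in t, forall z, A z}, separated r t & size t = k] >].
have exP : exists k, P k by exists 0%N; apply/asboolP; exists [::].
have ubP k : P k -> (k <= M)%N.
  by move=> /asboolP[t [tA ts <-]]; exact: bnd.
case: (ex_maxnP exP ubP) => k /asboolP[t [tA ts tk]] kmax.
exists t; split => // y Ay; apply: contrapT => yt.
have /kmax : P k.+1.
  apply/asboolP; exists (y :: t); split; last by rewrite /= tk.
    by move=> z; rewrite inE => /predU1P[->|/tA].
  rewrite /separated pairwise_cons; apply/andP; split; last exact: ts.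
  apply/allP => z zt.
  by apply/negP => /asboolP yz; apply: yt; apply/cubesP; exists z.
by rewrite ltnn.
Qed.

(** Disjoint cubes of radius r number at most a constant times r^(-s), because
    each carries energy kap r^s. Their union then has measure O(r^(n-s)), so
    little energy, and this improves the bound on the number of cubes to
    o(r^(-s)). *)
Lemma cover_of_density (f : 'rV[R]_n -> \bar R) A (R0 kap s rho0 eta del : R) :
  (forall x, 0 <= f x)%E -> L1_loc f -> A `<=` cube 0 R0 -> 0 < kap -> 0 < rho0 ->
  s < n%:R ->
  (forall z rho, A z -> 0 < rho -> rho < rho0 ->
    ((kap * rho `^ s)%:E <= \int[mu]_(x in cube z rho) f x)%E) ->
  0 < eta -> 0 < del ->
  exists2 r, 0 < r < del & exists t, [/\ {in t, forall z, A z},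
    A `<=` cubes (2 * r) t & (size t)%:R * r `^ s <= eta].
Proof.
move=> f0 fL AR kap0 rho00 sn dens eta0 del0.
pose K := cube (0 : 'rV[R]_n) (R0 + 1).
have mK : measurable K := @measurable_cube R n _ _.
have fK : mu.-integrable K f := fL _ (@compact_cube R n _ _).
have mfK := measurable_int _ fK.
have [dl dl0 small] := integral_small_set mK fK f0 (mulr_gt0 kap0 eta0).
pose B := fine (\int[mu]_(x in K) f x)%E.
have BE : (\int[mu]_(x in K) f x)%E = B%:E by rewrite fineK//; exact: integrable_fin_num.
have B0 : 0 <= B by rewrite fine_ge0// integral_ge0.
have ns0 : 0 < n%:R - s by rewrite subr_gt0.
(* r^(n-s) < c makes the union of the cubes smaller than dl. *)
pose c := dl * kap / (2 ^+ n * (B + 1)).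
have B1 : 0 < B + 1 by rewrite ltr_wpDl.
have c0 : 0 < c by rewrite divr_gt0 ?mulr_gt0// exprn_gt0.
pose r := Num.min (Num.min rho0 1) (Num.min del (c `^ (n%:R - s)^-1)) / 2.
have [r0 [rrho [r1 [rdel rc]]]] : 0 < r /\ r < rho0 /\ r < 1 /\ r < del /\ r < c `^ (n%:R - s)^-1.
  have cp : 0 < c `^ (n%:R - s)^-1 by exact: powR_gt0.
  have m0 : 0 < Num.min (Num.min rho0 1) (Num.min del (c `^ (n%:R - s)^-1)).
    by rewrite !lt_min rho00 ltr01 del0.
  have r_lt : r < Num.min (Num.min rho0 1) (Num.min del (c `^ (n%:R - s)^-1)).
    by rewrite /r ltr_pdivrMr// ltr_pMr// ltr1n.
  split; first by rewrite /r divr_gt0.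
  by move: r_lt; rewrite !lt_min => /andP[/andP[-> ->] /andP[-> ->]].
have rs0 : 0 < r `^ s by exact: powR_gt0.
have cK z : A z -> cube z r `<=` K.
  move=> /AR zR y yz i; have := zR i; have := yz i; rewrite !mxE !subr0 => h1 h2.
  rewrite -(subrK (z ord0 i) (y ord0 i)); apply: le_trans (ler_normD _ _) _.
  by rewrite addrC lerD// (le_trans h1)// ltW.
have energy t : {in t, forall z, A z} -> separated r t ->
    (((size t)%:R * (kap * r `^ s))%:E <= \int[mu]_(x in cubes r t) f x)%E.
  move=> tA ts; apply: integral_cubes_ge mK mfK f0 ts _ _ => z /tA zA.
    exact: cK.
  exact: dens.
have tK t : {in t, forall z, A z} -> cubes r t `<=` K.
  by move=> tA y /cubesP[z /tA /cK zK]; exact: zK.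
have sizeB t : {in t, forall z, A z} -> separated r t -> (size t)%:R * (kap * r `^ s) <= B.
  move=> tA ts; rewrite -lee_fin -BE; apply: le_trans (energy t tA ts) _.
  by apply: ge0_subset_integral => //; [exact: measurable_cubes|exact: tK].
have [|t [tA ts tcov]] := @maximal_separated A r (Num.bound (B / (kap * r `^ s))).
  move=> t tA ts; rewrite ltnW// -(ltr_nat R).
  apply: le_lt_trans (archi_boundP _); last by rewrite divr_ge0// ltW// mulr_gt0.
  by rewrite ler_pdivlMr ?mulr_gt0// sizeB.
exists r; first by rewrite r0.
exists t; split=> //.
have mut : (mu (cubes r t) < dl%:E)%E.
  apply: le_lt_trans (lebesgue_cubes_le t (ltW r0)) _; rewrite lte_fin.
  have rn : r ^+ n = r `^ (n%:R - s) * r `^ s.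
    by rewrite -powRD ?subrK ?powR_mulrn ?(ltW r0)// (gt_eqF r0) implybT.
  have rcs : r `^ (n%:R - s) < c.
    have := gt0_ltr_powR ns0 (ltW r0) (powR_ge0 _ _) rc.
    by rewrite -powRrM mulVf ?gt_eqF// powRr1// ltW.
  have h := sizeB t tA ts.
  have h' : (size t)%:R * r `^ s <= B / kap by rewrite ler_pdivlMr// -mulrA (mulrC _ kap).
  rewrite exprMn rn (_ : _ * _ = 2 ^+ n * r `^ (n%:R - s) * ((size t)%:R * r `^ s)); last by ring.
  apply: le_lt_trans (_ : 2 ^+ n * r `^ (n%:R - s) * ((B + 1) / kap) < _).
    rewrite ler_wpM2l ?mulr_ge0 ?powR_ge0 ?exprn_ge0// (le_trans h')// ler_wpM2r ?invr_ge0 ?(ltW kap0)//; lra.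
  rewrite (_ : dl = 2 ^+ n * c * ((B + 1) / kap)); last first.
    by rewrite /c; field; rewrite !gt_eqF// exprn_gt0.
  by rewrite ltr_pM2r ?divr_gt0// ltr_pM2l ?exprn_gt0.
have := small _ (measurable_cubes r t) (tK t tA) mut.
move=> /(le_lt_trans (energy t tA ts)); rewrite lte_fin mulrCA ltr_pM2l//.
exact: ltW.
Qed.
End covering.

(** * Null sets of Hausdorff measures *)

Section hausdorff.
Context (R : realType) (n : nat).
Implicit Types (A B : set 'rV[R]_n) (x y : 'rV[R]_n) (s rho eps del : R).
Local Open Scope ereal_scope.

(** Nullity for the Hausdorff measure, unfolded into the existence of covers:
    the form in which it is proved and combined. *)
Definition hausdorff_null s A := forall eps del, (0 < eps)%R -> (0 < del)%R ->
  exists F : (set 'rV[R]_n)^nat, [/\ A `<=` \bigcup_k F k,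
    forall k, diameter (F k) <= del%:E &
    \sum_(0 <= k <oo) hausdorff_gauge s (F k) <= eps%:E].

Lemma hausdorff_gauge_ge0 s A : 0 <= hausdorff_gauge s A.
Proof. by rewrite /hausdorff_gauge; case: ifP => // _; exact: poweR_ge0. Qed.

Lemma diameter_le A rho : (0 <= rho)%R ->
  (forall x y, A x -> A y -> (enorm (x - y) <= rho)%R) -> diameter A <= rho%:E.
Proof.
move=> rho0 Ar; apply: ge_ereal_sup => z [->|[x Ax [y Ay <-]]]; rewrite lee_fin//.
exact: Ar.
Qed.

Lemma diameter_ge0 A : 0 <= diameter A.
Proof. by apply: ereal_sup_ubound; left. Qed.

Lemma hausdorff_gauge_le s A rho : (0 <= s)%R -> (0 <= rho)%R ->
  (forall x y, A x -> A y -> (enorm (x - y) <= rho)%R) ->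
  hausdorff_gauge s A <= (rho `^ s)%:E.
Proof.
move=> s0 rho0 Ar; rewrite /hausdorff_gauge; case: ifP => _.
  by rewrite lee_fin powR_ge0.
rewrite -poweR_EFin; apply: gt0_ler_poweR => //.
- by rewrite in_itv/= diameter_ge0 leey.
- by rewrite in_itv/= lee_fin rho0 leey.
exact: diameter_le.
Qed.

Lemma hausdorff_null_measure0 s A : hausdorff_null s A -> hausdorff_measure s A = 0.
Proof.
move=> An; apply/eqP; rewrite eq_le; apply/andP; split.
  apply: ge_ereal_sup => _ [del /= del0 <-].
  apply/lee_addgt0Pr => eps eps0; rewrite add0e.
  have [F [AF Fd Fs]] := An _ _ eps0 del0.
  by apply: le_trans Fs; apply: ereal_inf_lbound; exists F.
apply: (@le_trans _ _ (hausdorff_delta s 1 A)); last first.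
  by apply: ereal_sup_ubound; exists 1%R => //=.
apply: le_ereal_inf_tmp => _ [F _ <-]; apply: nneseries_ge0 => k _ _.
exact: hausdorff_gauge_ge0.
Qed.

Lemma hausdorff_nullS s A B : A `<=` B -> hausdorff_null s B -> hausdorff_null s A.
Proof.
move=> AB Bn eps del eps0 del0; have [F [BF Fd Fs]] := Bn _ _ eps0 del0.
by exists F; split => //; exact: subset_trans BF.
Qed.

(** A finite cover by N sets is completed by empty sets, whose gauge is 0. *)
Lemma hausdorff_null_finite_cover s A : (0 <= s)%R ->
  (forall eps del, (0 < eps)%R -> (0 < del)%R ->
    exists rho, [/\ (0 < rho)%R, (rho <= del)%R & exists N (F : (set 'rV[R]_n)^nat),
      [/\ A `<=` \bigcup_(k < N) F k,
        forall k x y, (k < N)%N -> F k x -> F k y -> (enorm (x - y) <= rho)%R &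
        (N%:R * rho `^ s <= eps)%R]]) ->
  hausdorff_null s A.
Proof.
move=> s0 H eps del eps0 del0; have [rho [rho0 rhod [N [F [AF Fd Ns]]]]] := H _ _ eps0 del0.
pose G k := if (k < N)%N then F k else set0.
have Gd k x y : G k x -> G k y -> (enorm (x - y) <= rho)%R.
  by rewrite /G; case: ifP => // kN; exact: Fd.
exists G; split.
- by move=> x /AF[k /= kN Fkx]; exists k => //; rewrite /G kN.
- move=> k; apply: (@le_trans _ _ rho%:E); last by rewrite lee_fin.
  by apply: diameter_le; [exact: ltW|exact: Gd].
rewrite (nneseries_split 0 N) => [|k _]; last exact: hausdorff_gauge_ge0.
rewrite add0n [X in _ + X]eseries0 ?adde0; last first.
  by move=> k Nk _; rewrite /G ltnNge Nk/= /hausdorff_gauge eqxx.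
apply: le_trans (_ : (N%:R * rho `^ s)%:E <= _); last by rewrite lee_fin.
rewrite big_mkord; apply: le_trans (_ : \sum_(k < N) (rho `^ s)%:E <= _).
  by apply: lee_sum => k _; apply: hausdorff_gauge_le => //; [exact: ltW|exact: Gd].
by rewrite sumEFin sumr_const card_ord -[(_ *+ N)%R]mulr_natl.
Qed.

Lemma hausdorff_null_bigcup s (A : (set 'rV[R]_n)^nat) :
  (forall k, hausdorff_null s (A k)) -> hausdorff_null s (\bigcup_k A k).
Proof.
move=> An eps del eps0 del0.
have /choice[G PG] i : exists F : (set 'rV[R]_n)^nat, [/\ A i `<=` \bigcup_k F k,
    forall k, diameter (F k) <= del%:E &
    \sum_(0 <= k <oo) hausdorff_gauge s (F k) <= (eps / (2 ^ i.+1)%:R)%:E].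
  by apply: An => //; rewrite divr_gt0.
pose a (p : nat * nat) := hausdorff_gauge s (G p.1 p.2).
have a0 p : 0 <= a p by exact: hausdorff_gauge_ge0.
have /card_esym/ppcard_eqP[f] := card_nat2.
exists (fun k => G (f k).1 (f k).2); split.
- move=> x [i _ Aix]; have [/(_ x Aix)[j _ Gx] _ _] := PG i.
  by exists (f^-1%FUN (i, j)) => //=; rewrite invK ?inE.
- by move=> k; case: (PG (f k).1).
apply: (@le_trans _ _ (\esum_(p in setT) a p)).
  rewrite -[leLHS]/(\sum_(0 <= k <oo) (a (f k))).
  by rewrite -(esum_pred_image a f xpredT) ?[fun=> _]set_true// image_eq.
rewrite (_ : esum _ _ = \sum_(i <oo) \sum_(j <oo) a (i, j)); last first.
  pose J : nat -> set (nat * nat) := fun i => [set (i, j) | j in setT].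
  rewrite (_ : setT = \bigcup_k J k); last first.
    by rewrite predeqE => -[b c]; split => // _; exists b => //; exists c.
  rewrite esum_bigcupT /=; last 2 first.
    - apply/trivIsetP => i j _ _ ij.
      rewrite predeqE => -[m k] /=; split => //= -[] [_] _ [<-{m} _].
      by move=> [m' _] [] /esym/eqP; rewrite (negbTE ij).
    - by move=> ?; exact: a0.
  rewrite -(image_id [set: nat]) -fun_true esum_pred_image//; last first.
    by move=> k _; exact: esum_ge0.
  apply: eq_eseriesr => /= j _.
  rewrite -(esum_pred_image a (pair j) predT)//=; last first.
    by move=> ? ? _ _; exact: (@can_inj _ _ _ snd).
  by congr esum; rewrite predeqE => -[b c]; split; move=> [i _ <-]; exists i.
apply: (@le_trans _ _ (\sum_(0 <= i <oo) (eps / (2 ^ i.+1)%:R)%:E)).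
  apply: lee_nneseries => i _ *; last by case: (PG i).
  by apply: nneseries_ge0 => j _ _; exact: a0.
by apply: epsilon_trick0; exact: ltW.
Qed.
End hausdorff.

(** * End points of light segments *)

Section endpoints.
Context (R : realType) (n : nat).
Implicit Types (u : 'rV[R]_n -> R) (Du : 'rV[R]_n -> 'rV[R]_n).
Implicit Types (x y z e p : 'rV[R]_n) (l d s q : R).
Local Notation mu := (lebesgue_rV R n).
Local Notation hq Du q := (fun x => (lorentz_factor (Du x) `^ q)%E).

Lemma light_ray_affine u x e l t : lipschitz1 u -> light_ray u x e l ->
  0 <= t -> t <= l -> u (x + t *: e) = u x + t.
Proof.
move=> ul [e1 l0 ue] t0 tl; apply/eqP; rewrite eq_le; apply/andP; split.
  have := ul (x + t *: e) x.
  by rewrite addrAC subrr add0r enormZ e1 mulr1 ger0_norm// lerBlDl.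
have := ul (x + l *: e) (x + t *: e); rewrite ue.
rewrite (_ : _ - _ = (l - t) *: e); last by apply/rowP => i; rewrite !mxE; ring.
by rewrite enormZ e1 mulr1 ger0_norm ?subr_ge0//; lra.
Qed.

Lemma light_ray_sub u x e l a b : lipschitz1 u -> light_ray u x e l ->
  0 <= a -> a < b -> b <= l -> light_ray u (x + a *: e) e (b - a).
Proof.
move=> ul ray a0 ab bl; have [e1 l0 ue] := ray; split => //; first by rewrite subr_gt0.
rewrite -addrA -scalerDl (addrC a) subrK !(light_ray_affine ul ray)//; try lra.
Qed.

(** The two Lipschitz bounds between opposite ends of the rays bound
    |d (e + e') + w| and |d (e + e') - w| from below, with w = z - z'. By the
    parallelogram identity |e + e'| is then close to 2, and |e - e'| is small. *)
Lemma light_direction_lipschitz u z z' e e' d : lipschitz1 u ->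
  light_ray u (z - d *: e) e (2 * d) -> light_ray u (z' - d *: e') e' (2 * d) ->
  d * enorm (e - e') <= enorm (z - z').
Proof.
move=> ul ray ray'; have [e1 dd ue] := ray; have [e1' _ ue'] := ray'.
have d0 : 0 < d by rewrite -(pmulr_rgt0 _ (ltr0n R 2)).
(* If the midpoints are far apart, |e - e'| <= 2 is enough. *)
have [w2|w2] := leP (2 * d) (enorm (z - z')).
  apply: le_trans w2; rewrite mulrC ler_pM2r//.
  by apply: le_trans (enormD _ _) _; rewrite enormN e1 e1'.
have h1 := ul (z - d *: e + (2 * d) *: e) (z' - d *: e').
have h2 := ul (z' - d *: e' + (2 * d) *: e') (z - d *: e).
rewrite ue in h1; rewrite ue' in h2.
pose w := z - z'; pose X := d *: (e + e').
have E1 : z - d *: e + (2 * d) *: e - (z' - d *: e') = X + w.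
  by apply/rowP => i; rewrite !mxE; ring.
have E2 : z' - d *: e' + (2 * d) *: e' - (z - d *: e) = X - w.
  by apply/rowP => i; rewrite !mxE; ring.
rewrite {}E1 in h1; rewrite {}E2 in h2.
(* This makes the left sides of the two lower bounds nonnegative, so that they can
   be squared. *)
have Xle : enorm X <= 2 * d.
  rewrite enormZ gtr0_norm// mulrC ler_pM2r//.
  by apply: le_trans (enormD _ _) _; rewrite e1 e1'.
have Xw := enormD X w; have Xw' := enormD X (- w); rewrite enormN in Xw'.
have P1 := parallelogram X w; have P2 := parallelogram e e'; rewrite e1 e1' in P2.
have XE : enorm X ^+ 2 = d ^+ 2 * enorm (e + e') ^+ 2.
  by rewrite enormZ exprMn real_normK// num_real.
rewrite -(@ler_pXn2r _ 2) ?nnegrE ?enorm_ge0 ?mulr_ge0 ?enorm_ge0 ?(ltW d0)//.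
rewrite -/w exprMn; rewrite -/w in w2.
move: (u (z - d *: e)) (u (z' - d *: e')) h1 h2 => p p' h1 h2.
have m1 : 0 <= 2 * d + (p - p') by lra.
have m2 : 0 <= 2 * d - (p - p') by lra.
have s1 : (2 * d + (p - p')) ^+ 2 <= enorm (X + w) ^+ 2.
  by rewrite ler_pXn2r ?nnegrE ?enorm_ge0//; lra.
have s2 : (2 * d - (p - p')) ^+ 2 <= enorm (X - w) ^+ 2.
  by rewrite ler_pXn2r ?nnegrE ?enorm_ge0//; lra.
have pp := sqr_ge0 (p - p').
have P3 : d ^+ 2 * enorm (e - e') ^+ 2 = 4 * d ^+ 2 - enorm X ^+ 2.
  by rewrite XE -[enorm (e - e') ^+ 2](addKr (enorm (e + e') ^+ 2)) P2; ring.
rewrite P3; lra.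
Qed.

Lemma light_segment_ray u x y : light_segment u x y ->
  exists x0 e l, light_ray u x0 e l /\
    (forall z, closed_segment x y z -> exists2 t, 0 <= t <= l & z = x0 + t *: e).
Proof.
move=> [xy]; pose l := enorm (y - x).
have l0 : 0 < l.
  rewrite lt_neqAle enorm_ge0 andbT; apply/eqP => /esym/enorm0_eq /eqP.
  by rewrite subr_eq0 => /eqP /esym.
have lV : l * l^-1 = 1 by rewrite divff// gt_eqF.
have e1 v : enorm v = l -> enorm (l^-1 *: v) = 1.
  by move=> vl; rewrite enormZ vl gtr0_norm ?invr_gt0// mulrC.
have uxyE : enorm (x - y) = l by rewrite enormB.
rewrite uxyE; have [_|_] := ler0P (u x - u y) => uE.
  exists x, (l^-1 *: (y - x)), l; split.
    split => //; first exact: e1.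
    by rewrite scalerA lV scale1r (addrC x) subrK; lra.
  move=> _ [t /andP[t0 t1] ->]; exists (t * l).
    by rewrite mulr_ge0 ?(ltW l0)// ler_piMl// ltW.
  by rewrite scalerA -mulrA lV mulr1; apply/rowP => i; rewrite !mxE; ring.
exists y, (l^-1 *: (x - y)), l; split.
  split => //; first exact: e1.
  by rewrite scalerA lV scale1r (addrC y) subrK; lra.
move=> _ [t /andP[t0 t1] ->]; exists ((1 - t) * l).
  by rewrite mulr_ge0 ?(ltW l0) ?subr_ge0// ler_piMl ?(ltW l0)// gerBl.
by rewrite scalerA -mulrA lV mulr1; apply/rowP => i; rewrite !mxE; ring.
Qed.

(** The parity of b selects the far end or the origin of the ray with midpoint z. *)
Definition light_ends u d (b : nat) (A : set 'rV[R]_n) :=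
  [set p | exists z e, [/\ light_ray u (z - d *: e) e (2 * d), A z &
    p = z + ((-1) ^+ b * d) *: e]].

(** The bounded pieces on which the density bound holds with one constant and
    one range of radii. *)
Definition dense_points (f : 'rV[R]_n -> \bar R) s (k : nat) :=
  [set z : 'rV[R]_n | cube 0 k%:R z /\ forall rho, 0 < rho -> rho < k.+1%:R^-1 ->
    ((k.+1%:R^-1 * rho `^ s)%:E <= \int[mu]_(x in cube z rho) f x)%E].

(** A point of a light segment is an end point of a light segment with half
    length 1 / (j + 1) for all large j: take the part of the original segment on
    the longer side of the point. *)
Lemma light_set_ends u Du q : W1infty_loc u Du -> weakly_spacelike Du -> lipschitz1 u ->
  L1_loc (hq Du q) -> 0 < q ->
  light_set u `<=` \bigcup_j \bigcup_k \bigcup_b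
    light_ends u j.+1%:R^-1 b (dense_points (hq Du q) (n%:R - q / 2) k).
Proof.
move=> uW Du1 ul hL q0 p [x [y [/light_segment_ray[x0 [e [l [ray seg]]]] /seg[t /andP[t0 tl] ->]]]].
have [e1 l0 _] := ray.
pose j := Num.bound (4 / l); pose d : R := j.+1%:R^-1.
have d0 : 0 < d by rewrite invr_gt0.
have dl : 2 * d <= l / 2.
  have : 4 / l < j.+1%:R.
    by apply: lt_trans (archi_boundP _) _; rewrite ?divr_ge0 ?(ltW l0)// ltr_nat.
  rewrite ltr_pdivrMr// => h.
  by rewrite /d ler_pdivrMr// ltW//; lra.
suff [b [z [rz pz]]] : exists b z, light_ray u (z - d *: e) e (2 * d) /\
    x0 + t *: e = z + ((-1) ^+ b * d) *: e.
  exists j => //.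
  have [kap kap0 [rho0 rho00 dens]] := light_ray_density uW Du1 ul hL q0 rz.
  have zE : z - d *: e + (2 * d / 2) *: e = z.
    by rewrite mulrC mulKf// subrK.
  rewrite zE in dens.
  pose k := Num.bound (enorm z + kap^-1 + rho0^-1).
  have kb : enorm z + kap^-1 + rho0^-1 < k%:R.
    by apply: archi_boundP; rewrite !addr_ge0 ?enorm_ge0 ?invr_ge0 ?(ltW kap0) ?(ltW rho00).
  have kap1 : 0 <= kap^-1 by rewrite invr_ge0 ltW.
  have rho1 : 0 <= rho0^-1 by rewrite invr_ge0 ltW.
  have kk : k%:R < k.+1%:R :> R by rewrite ltr_nat.
  have z0 := enorm_ge0 z.
  have kk0 : 0 < k.+1%:R :> R by [].
  exists k => //; exists b => //; exists z, e; split => //; split.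
    move=> i; rewrite mxE subr0; apply: le_trans (_ : enorm z <= _); last lra.
    exact: enorm_coord.
  move=> rho r0 rk; apply: le_trans (dens rho r0 _); last first.
    apply: lt_le_trans rk _; rewrite -[leRHS]invrK lef_pV2 ?posrE ?invr_gt0//; lra.
  rewrite lee_fin ler_wpM2r ?powR_ge0// -[leRHS]invrK lef_pV2 ?posrE ?invr_gt0//; lra.
have [tl2|tl2] := leP t (l / 2).
  exists 1%N, (x0 + (t + d) *: e).
  have tt : t + 2 * d <= l by lra.
  have tt' : t < t + 2 * d by lra.
  have := light_ray_sub ul ray t0 tt' tt.
  rewrite (_ : t + 2 * d - t = 2 * d); last by ring.
  rewrite (_ : x0 + (t + d) *: e - d *: e = x0 + t *: e); last by apply/rowP => i; rewrite !mxE; ring.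
  move=> h; split=> //; by apply/rowP => i; rewrite !mxE expr1; ring.
exists 0%N, (x0 + (t - d) *: e).
have tt : 0 <= t - 2 * d by lra.
have tt' : t - 2 * d < t by lra.
have := light_ray_sub ul ray tt tt' tl.
rewrite (_ : t - (t - 2 * d) = 2 * d); last by ring.
rewrite (_ : x0 + (t - d) *: e - d *: e = x0 + (t - 2 * d) *: e); last by apply/rowP => i; rewrite !mxE; ring.
move=> h; split=> //; by apply/rowP => i; rewrite !mxE expr0; ring.
Qed.

(** The end point z + d e or z - d e is a 2-Lipschitz function of the midpoint z.
    A cover of the midpoints by cubes 2 r gives a cover of the end points by sets
    of diameter at most 8 n r. *)
Lemma hausdorff_null_light_ends u (f : 'rV[R]_n -> \bar R) s d b k : lipschitz1 u ->
  (forall x, 0 <= f x)%E -> L1_loc f -> 0 <= s -> s < n%:R -> 0 < d ->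
  hausdorff_null s (light_ends u d b (dense_points f s k)).
Proof.
move=> ul f0 fL s0 sn d0; apply: hausdorff_null_finite_cover => // eps del eps0 del0.
have n0 : 0 < n%:R :> R by exact: le_lt_trans sn.
pose C : R := 8 * n%:R; have C0 : 0 < C by rewrite mulr_gt0.
have Cs0 : 0 < C `^ s by exact: powR_gt0.
have kap0 : 0 < k.+1%:R^-1 :> R by rewrite invr_gt0.
have [||||r /andP[r0 rdel] [t [tA tcov tsize]]] :=
    @cover_of_density R n f (dense_points f s k) k%:R k.+1%:R^-1 s k.+1%:R^-1
      (eps / C `^ s) (del / C) f0 fL _ kap0 kap0 sn _ _ _.
- by move=> z [].
- by move=> z rho [_ h]; exact: h.
- by rewrite divr_gt0.
- by rewrite divr_gt0.
exists (C * r); split; first by rewrite mulr_gt0.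
  by rewrite mulrC -ler_pdivlMr// ltW.
exists (size t), (fun i => light_ends u d b (dense_points f s k `&` cube (nth 0 t i) (2 * r))).
split.
- move=> p [z [e [rz Az pz]]]; have /cubesP[a at_ az] := tcov z Az.
  exists (index a t); first by rewrite /= index_mem.
  by exists z, e; split => //; split => //; rewrite nth_index.
- move=> i p p' _ [z [e [rz [_ az] ->]]] [z' [e' [rz' [_ az'] ->]]].
  have dl := light_direction_lipschitz ul rz rz'.
  rewrite (_ : _ - _ = (z - z') + ((-1) ^+ b * d) *: (e - e')); last first.
    by apply/rowP => j; rewrite !mxE; ring.
  apply: le_trans (enormD _ _) _; rewrite enormZ normrM normrX normrN1 expr1n mul1r gtr0_norm//.
  have zz : enorm (z - z') <= n%:R * (4 * r).
    apply: enorm_le_cube1; first by rewrite mulr_ge0// ltW.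
    move=> j; rewrite !mxE subr0.
    rewrite (_ : z ord0 j - z' ord0 j = (z ord0 j - nth 0 t i ord0 j) -
      (z' ord0 j - nth 0 t i ord0 j)); last by ring.
    by apply: le_trans (ler_normB _ _) _; have := az j; have := az' j; lra.
  rewrite /C; lra.
rewrite powRM ?(ltW C0) ?(ltW r0)// mulrCA mulrC -ler_pdivlMr//.
Qed.

Lemma hausdorff_null_light_set u Du q : W1infty_loc u Du -> weakly_spacelike Du -> lipschitz1 u ->
  L1_loc (hq Du q) -> 0 < q -> q / 2 <= n%:R ->
  hausdorff_null (n%:R - q / 2) (light_set u).
Proof.
move=> uW Du1 ul hL q0 qn.
apply: hausdorff_nullS (light_set_ends uW Du1 ul hL q0) _.
do 3 (apply: hausdorff_null_bigcup => ?); apply: hausdorff_null_light_ends => //.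
- by move=> x; exact: poweR_ge0.
- by rewrite subr_ge0.
- by rewrite gtrBl divr_gt0.
Qed.

Lemma light_set_empty u Du q : (2 <= n)%N ->
  W1infty_loc u Du -> weakly_spacelike Du -> lipschitz1 u ->
  L1_loc (hq Du q) -> 1 <= q -> n%:R - 1 <= q -> light_set u = set0.
Proof.
move=> n2 uW Du1 ul hL q1 nq; apply/seteqP; split => // z [x [y [/light_segment_ray]]].
by move=> [x0 [e [l [ray _]]]] _; exact: no_light_ray n2 uW Du1 ul hL q1 nq ray.
Qed.

End endpoints.

Unset Implicit Arguments.

Theorem theorem1p11 (R : realType) (n : nat) (n_ge2 : (2 <= n)%N)
    (u : 'rV[R]_n -> R) (Du : 'rV[R]_n -> 'rV[R]_n)
    (u_lip : locally_lipschitz u) (u_W : W1infty_loc u Du)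
    (u_ws : weakly_spacelike Du) :
  (forall q : R, 1 <= q ->
    L1_loc (fun x => (lorentz_factor (Du x) `^ q)%E) ->
    (q < n%:R - 1 -> hausdorff_measure (n%:R - q / 2) (light_set u) = 0%E) /\
    (n%:R - 1 <= q -> light_set u = set0 /\ light_closure u = set0)) /\
  (n = 2%N -> L1_loc (fun x => lorentz_factor (Du x)) ->
    [/\ light_interior_set u = set0, light_set u = set0 &
        light_closure u = set0]).
Proof.
have ul := spacelike_lipschitz u_lip u_W u_ws.
have empty q : 1 <= q -> L1_loc (fun x => (lorentz_factor (Du x) `^ q)%E) ->
    n%:R - 1 <= q -> light_set u = set0 /\ light_closure u = set0.
  move=> q1 hL nq; have S0 := light_set_empty n_ge2 u_W u_ws ul hL q1 nq.
  by rewrite /light_closure S0 closure0.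
split=> [q q1 hL|n2 hL].
  split=> [qn|]; last exact: empty.
  by apply/hausdorff_null_measure0/(hausdorff_null_light_set u_W) => //; lra.
have [|||S0 K0] := empty 1 => //.
- rewrite (_ : (fun _ => _) = fun x => lorentz_factor (Du x))//.
  apply/funext => x; rewrite poweRe1// /lorentz_factor.
  by case: ifP => // _; rewrite lee_fin invr_ge0 sqrtr_ge0.
- by rewrite n2; lra.
split => //; apply/seteqP; split => // z [x [y [xy [t /andP[t0 t1] zE]]]].
rewrite -[set0]S0; exists x, y; split => //; exists t => //.
by rewrite !ltW.
Qed.
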